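(* Let $\mathcal{X}=\{\mathbf{x}\in[0,1]^d:\ \mathbf{1}^\top\mathbf{x}=s\}$ and $\varphi(\cdot)=-\log(\cdot)$. Let $\mathbf{C}=\mathbf{V}^\top\mathbf{V}\in\mathbb{S}^d_+$ with $s\le\operatorname{rank}(\mathbf{C})$, and define, for $\mathbf{x}\in\mathcal{X}$ and $\boldsymbol{\rho}\in\mathbb{R}^d$, $$f_{\Gamma\text{-g}}(\mathbf{x},\boldsymbol{\rho})=G_s\big(\mathbf{V}\,\mathrm{Diag}(\exp(\boldsymbol{\rho}))\,\mathrm{Diag}(\mathbf{x})\,\mathbf{V}^\top\big)+\sum_{i=1}^d x_i\rho_i .$$ Then applying generalized scaling to the $\Gamma$ relaxation yields no improvement, that is, $$\min_{\mathbf{x}\in\mathcal{X}}\ \max_{\boldsymbol{\rho}\in\mathbb{R}^d} f_{\Gamma\text{-g}}(\mathbf{x},\boldsymbol{\rho})=\min_{\mathbf{x}\in\mathcal{X}} f_{\Gamma\text{-g}}(\mathbf{x},\mathbf{0}).$$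
   Context: $\mathbb{S}^d$ is the space of real symmetric $d\times d$ matrices, $\mathbb{S}^d_+$ its positive semidefinite cone; $\boldsymbol{\lambda}(\mathbf{X})$ is the vector of eigenvalues of $\mathbf{X}$ in nonincreasing order. $\mathbf{1}$ is the all-ones vector, $\mathrm{Diag}(\mathbf{x})$ the diagonal matrix with diagonal $\mathbf{x}$, $\exp$ is applied componentwise. $\mathbf{V}\in\mathbb{R}^{d\times d}$ and $1\le s\le d$ is an integer. $\mathbb{K}_{o,d}=\{\mathbf{x}\in\mathbb{R}^d: x_1\ge\dots\ge x_d\}$. For $\mathbf{u},\mathbf{w}\in\mathbb{R}^d$, $\mathbf{u}\succcurlyeq_m\mathbf{w}$ ($\mathbf{u}$ majorizes $\mathbf{w}$) means that $\sum_i u_i=\sum_i w_i$ and for each $j\le d-1$ the sum of the $j$ largest entries of $\mathbf{u}$ is at least the sum of the $j$ largest entries of $\mathbf{w}$. With $\varphi=-\log$ (and $-\log t=+\infty$ for $t\le 0$), $G_s(\mathbf{X})=g_s(\boldsymbol{\lambda}(\mathbf{X}))$ where $$g_s(\boldsymbol{\lambda})=\min_{\boldsymbol{\xi}\in\mathbb{R}^d_+}\Big\{-\sum_{i=1}^s\log\xi_i:\ \boldsymbol{\xi}\succcurlyeq_m\boldsymbol{\lambda},\ \boldsymbol{\xi}\in\mathbb{K}_{o,d}\Big\},$$ so $G_s$ is finite exactly on positive semidefinite matrices of rank at least $s$, and is $+\infty$ elsewhere. Minima and maxima are understood as infima/suprema in the extended reals. The right-hand side is the $\Gamma$ (factorization)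 relaxation bound $\mathrm{Opt}_\Gamma$ and the left-hand side its generalized-scaling version $\mathrm{Opt}_{\Gamma\text{-g}}$. *)

(* Defs.v *)
From mathcomp Require Import all_boot all_order all_algebra.
From mathcomp Require Import all_classical all_reals all_analysis.
From mathcomp Require Import spectral sesquilinear complex.

Set Implicit Arguments.
Unset Strict Implicit.
Unset Printing Implicit Defensive.
Import Order.TTheory GRing.Theory Num.Theory.
Local Open Scope classical_set_scope.
Local Open Scope ring_scope.

Definition nonincr {R : realType} {d : nat} (x : 'rV[R]_d) : Prop :=
  forall i j : 'I_d, (i <= j)%N -> x 0 j <= x 0 i.

(* [l] lists the eigenvalues of [X], with multiplicity, in nonincreasing
   order. *)
Definition is_eigvals {R : realType} {d : nat} (X : 'M[R]_d) (l : 'rV[R]_d) :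
  Prop :=
  nonincr l /\ char_poly X = \prod_(i < d) ('X - (l 0 i)%:P).

(* Meaningful for symmetric [X] only, where [eigvalsP] and [is_eigvals_inj]
   give existence and uniqueness; the value is arbitrary when the characteristic
   polynomial does not split over the reals. *)
Definition eigvals {R : realType} {d : nat} (X : 'M[R]_d) : 'rV[R]_d :=
  xget 0 [set l | is_eigvals X l].

Definition topsum {R : realType} {d : nat} (j : nat) (u : 'rV[R]_d) : R :=
  \sum_(x <- take j (sort >=%R [seq u 0 i | i <- enum 'I_d])) x.

Definition majorizes {R : realType} {d : nat} (u w : 'rV[R]_d) : Prop :=
  \sum_i u 0 i = \sum_i w 0 i /\
  forall j : nat, (j <= d.-1)%N -> topsum j w <= topsum j u.

(* [lne] is [-oo] on nonpositive reals, and [ereal_inf set0 = +oo]. *)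
Definition g {R : realType} {d : nat} (s : nat) (l : 'rV[R]_d) : \bar R :=
  ereal_inf [set (\sum_(i < d | (i < s)%N) - lne (xi 0 i)%:E)%E
            | xi in [set xi : 'rV[R]_d |
                [/\ forall i, 0 <= xi 0 i, majorizes xi l & nonincr xi]]].

Definition G {R : realType} {d : nat} (s : nat) (X : 'M[R]_d) : \bar R :=
  g s (eigvals X).

Definition feasible (R : realType) (d s : nat) : set 'rV[R]_d :=
  [set x | (forall i, 0 <= x 0 i <= 1) /\ \sum_i x 0 i = s%:R].
Arguments feasible R d s : clear implicits.

Definition f_Gamma_g {R : realType} {d : nat} (s : nat) (V : 'M[R]_d)
    (x rho : 'rV[R]_d) : \bar R :=
  (G s (V *m diag_mx (map_mx expR rho) *m diag_mx x *m V^T)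
   + (\sum_i x 0 i * rho 0 i)%:E)%E.

Lemma prod_XsubC_perm {R : idomainType} (s t : seq R) :
  \prod_(x <- s) ('X - x%:P) = \prod_(x <- t) ('X - x%:P) -> perm_eq s t.
Proof.
elim: s t => [|x s IHs] t.
  rewrite big_nil => /(congr1 (fun p : {poly R} => size p)).
  by rewrite size_prod_XsubC size_poly1; case: t.
move=> eq_st; have xt : x \in t.
  by rewrite -root_prod_XsubC -eq_st root_prod_XsubC mem_head.
rewrite perm_sym; apply: (perm_trans (perm_to_rem xt)).
rewrite perm_cons perm_sym; apply: IHs.
move: eq_st; rewrite (perm_big _ (perm_to_rem xt)) !big_cons /=.
by apply: mulfI; rewrite polyXsubC_eq0.
Qed.

Lemma char_poly_invmx_mul {F : fieldType} {n : nat} (P D : 'M[F]_n) :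
  P \in unitmx -> char_poly (invmx P *m D *m P) = char_poly D.
Proof.
move=> uP; rewrite /char_poly /char_poly_mx.
have PK : map_mx polyC (invmx P) *m map_mx polyC P = 1%:M.
  by have := map_mxM polyC (invmx P) P; rewrite mulVmx // map_mx1 => ->.
have -> : 'X%:M - map_mx polyC (invmx P *m D *m P) =
    map_mx polyC (invmx P) *m ('X%:M - map_mx polyC D) *m map_mx polyC P.
  by rewrite mulmxBr mulmxBl !map_mxM /= scalar_mxC -(mulmxA 'X%:M) PK mulmx1.
by rewrite !det_mulmx mulrAC -det_mulmx PK det1 mul1r.
Qed.

Lemma nonincr_sorted {R : realType} {d : nat} (l : 'rV[R]_d) :
  nonincr l -> sorted >=%R [seq l 0 i | i <- enum 'I_d].
Proof.
move=> hl; rewrite sorted_map.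
apply: (@sub_sorted _ (relpre val leq)) => [i j /= ij|]; first exact: hl.
by rewrite -sorted_map val_enum_ord iota_sorted.
Qed.

Lemma is_eigvals_inj {R : realType} {d : nat} (X : 'M[R]_d) l l' :
  is_eigvals X l -> is_eigvals X l' -> l = l'.
Proof.
move=> [hl eX] [hl']; rewrite eX => eq_ll'.
have eqs : [seq l 0 i | i <- enum 'I_d] = [seq l' 0 i | i <- enum 'I_d].
  apply: (sorted_eq (leT := >=%R)); rewrite ?nonincr_sorted //.
  - exact: ge_trans.
  - by move=> x y /andP[] ? ?; apply/le_anti/andP.
  by apply: prod_XsubC_perm; rewrite !big_image.
apply/rowP => i; have /eq_in_map := eqs; apply; exact: mem_enum.
Qed.

Lemma is_eigvals_exists {R : realType} {d : nat} (X : 'M[R]_d) :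
  X^T = X -> exists l, is_eigvals X l.
Proof.
move=> XT; pose Y : 'M[R[i]]_d := map_mx (real_complex R) X.
have Yreal : Y \is a realmx.
  by apply/mxOverP => i j; rewrite mxE; apply/complex_realP; exists (X i j).
have Yherm : Y \is hermsymmx.
  apply: realsym_hermsym => //; apply/is_hermitianmxP.
  rewrite expr0 scale1r map_mx_id //; apply/matrixP => i j.
  by rewrite !mxE -{1}XT mxE.
have /orthomx_spectralP Ydiag := hermitian_normalmx Yherm.
have /mxOverP sp_real := hermitian_spectral_diag_real Yherm.
pose r i : R := complex.Re (spectral_diag Y 0 i).
have chiY : char_poly Y = \prod_(i < d) ('X - ((r i)%:C)%C%:P).
  transitivity (char_poly (diag_mx (spectral_diag Y))).
    by rewrite {1}Ydiag char_poly_invmx_mul ?spectral_unit.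
  rewrite char_poly_trig ?diag_mx_is_trig //; apply: eq_bigr => i _.
  by rewrite mxE eqxx mulr1n RRe_real.
have chiX : char_poly X = \prod_(i < d) ('X - (r i)%:P).
  apply: (map_poly_inj (real_complex R)); rewrite map_char_poly chiY.
  by rewrite map_prod_XsubC.
pose s := sort >=%R [seq r i | i <- enum 'I_d].
have sz_s : size s = d by rewrite size_sort size_map size_enum_ord.
exists (\row_i s`_i); split.
  move=> i j ij; rewrite !mxE.
  apply: (sorted_leq_nth (leT := >=%R)); rewrite ?inE ?sz_s //.
  - exact: ge_trans.
  - by move=> x; exact: lexx.
  by apply: sort_sorted => x y; exact: le_total.
rewrite chiX; transitivity (\prod_(x <- s) ('X - x%:P)).
  by rewrite (perm_big _ (permEl (perm_sort _ _))) big_image.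
rewrite (big_nth 0) sz_s big_mkord; by apply: eq_bigr => i _; rewrite mxE.
Qed.

Lemma eigvalsP {R : realType} {d : nat} (X : 'M[R]_d) :
  X^T = X -> is_eigvals X (eigvals X).
Proof. by move=> /is_eigvals_exists[l Xl]; apply: (xgetPex 0); exists l. Qed.

(* Main.v *)
Require Import Defs.
From mathcomp Require Import all_boot all_order all_algebra.
From mathcomp Require Import all_classical all_reals all_analysis.
From mathcomp Require Import fingroup perm zify ring lra.
Set Implicit Arguments.
Unset Strict Implicit.
Unset Printing Implicit Defensive.
Import numFieldNormedType.Exports.
Import Order.TTheory GRing.Theory Num.Theory.
Local Open Scope classical_set_scope.
Local Open Scope ring_scope.

(** Write F(y) = V Diag(y) V^T, and let E(X) be the largest product
    xi_1 ... xi_s over the vectors xi admissible for the eigenvalues of X, so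
    that G_s(X) = - log E(X). Evaluating the supremum at rho = 0 gives one
    inequality. The other one follows from a minimizer x of f(., 0) at which
    rho = 0 maximizes f(x, .), that is, from a maximizer x of E(F(x)) with
      E(F(x e^rho)) >= E(F(x)) e^(sum_j x_j rho_j)   for all rho.

    The function E o F involves eigenvalues in sorted order and is awkward to
    differentiate. What replaces derivatives is that, on the nonnegative
    orthant, E o F is the pointwise maximum of the multiaffine polynomials
      q(y) = sum_(|S| = s) q_S prod_(j in S) y_j,   q_S >= 0,
    that lie below it ([minorant], [minorant_touching]). The coefficients of
    these polynomials are bounded, so q(x) attains a maximum over all pairs
    (x, q) ([joint_maximizer]); its value is also the maximum of E o F.
    For the optimal pair, x maximizes the polynomial q over the feasible
    points. The weights q_S prod_(j in S) x_j, divided by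
    q(x), are a probability on the subsets S of size s. First order optimality
    says that the ratio (probability of j in S) / x_j is constant where
    0 < x_j < 1 and not smaller where x_j = 1; as it cannot exceed 1 there and
    has weighted mean 1, it is 1 on the whole support ([maximizer_marginals]).
    Jensen's inequality for the exponential then gives
      q(x e^rho) >= q(x) e^(sum_j x_j rho_j)   ([multiaffine_exp_ge]),
    and q <= E o F finishes the proof.

    The minorant touching E o F at a point x is built as follows. Let l be the
    spectrum of F(x). The optimal xi keeps l_1, ..., l_k and replaces the other
    entries by s - k copies of a level theta ([water_level]); let tau_j be l_j
    for j <= k and theta for j > k. Then mu_j = l_j / tau_j lies in [0, 1] and
    sums to s, so the mu_j are the squared row norms of an isometry H with s
    columns, the Schur-Horn theorem for projections ([isometry_with_diag]). In
    an eigenbasis P of F(x), combine the principal s x s minors of P X P^T with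
    the weights det(H_S)^2 / prod_(j in S) mu_j into a function Q(X). By the
    Cauchy-Binet formula Q(F(y)) is a multiaffine polynomial in y with
    nonnegative coefficients, and at y = x it equals E(F(x)). That Q(X) <= E(X)
    for every positive semidefinite X ([minor_sum_le_headprod]) comes from
    Cauchy-Binet in an eigenbasis of X, Hadamard's inequality, and the
    inequality of arithmetic and geometric means for H^T Diag(.) H. *)

(** * The Cauchy-Binet formula *)

(** Cauchy-Binet, summed over all index functions rather than over subsets:
    functions that are not injective contribute zero, and each subset of size s
    is the image of s! injective ones, whence the factor s!. Expanding the
    determinant by multilinearity gives an asymmetric formula, which is then
    averaged over the permutations of the index function. *)
Lemma fact_mul_det_mulmx (F : comNzRingType) (s n : nat)
    (A : 'M[F]_(s, n)) (B : 'M[F]_(n, s)) :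
  (s`!)%:R * \det (A *m B) =
  \sum_(f : {ffun 'I_s -> 'I_n}) \det (colsub f A) * \det (rowsub f B).
Proof.
have detAB (p : 'S_s) : \det (A *m B) = \sum_(f : {ffun 'I_s -> 'I_n})
    ((-1) ^+ p * \prod_i A i (f (p i))) * \det (rowsub f B).
  transitivity (\sum_(f : {ffun 'I_s -> 'I_n})
      (\prod_i A i (f i)) * \det (rowsub f B)).
    transitivity (\sum_(q : 'S_s) \sum_(f : {ffun 'I_s -> 'I_n})
        (-1) ^+ q * \prod_i (A i (f i) * B (f i) (q i))).
      apply: eq_bigr => q _; rewrite -mulr_sumr; congr (_ * _).
      rewrite -(bigA_distr_bigA (fun i j => A i j * B j (q i))).
      by apply: eq_bigr => i _; rewrite mxE.
    rewrite exchange_big; apply: eq_bigr => f _ /=.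
    rewrite [\det _]/determinant mulr_sumr; apply: eq_bigr => q _.
    rewrite big_split /= mulrCA; congr (_ * (_ * _)).
    by apply: eq_bigr => i _; rewrite mxE.
  pose h (g : {ffun 'I_s -> 'I_n}) : {ffun 'I_s -> 'I_n} := [ffun i => g (p i)].
  have h_inj : injective h.
    move=> g g' eqh; apply/ffunP => i.
    by have /ffunP/(_ (p^-1 i)%g) := eqh; rewrite !ffunE permKV.
  rewrite (reindex_inj h_inj); apply: eq_bigr => g _.
  have -> : rowsub (h g) B = row_perm p (rowsub g B).
    by apply/matrixP => i j; rewrite !mxE ffunE.
  rewrite row_permE det_mulmx det_perm mulrA; congr (_ * _).
  rewrite mulrC; congr (_ * _).
  by apply: eq_bigr => i _; rewrite ffunE.
transitivity (\sum_(p : 'S_s) \det (A *m B)).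
  by rewrite sumr_const card_Sn mulr_natl.
rewrite (eq_bigr _ (fun p _ => detAB p)) exchange_big.
apply: eq_bigr => f _; rewrite -mulr_suml; congr (_ * _).
rewrite [RHS]/determinant; apply: eq_bigr => p _; congr (_ * _).
by apply: eq_bigr => i _; rewrite mxE.
Qed.

Lemma det_colsub_ninj (F : comNzRingType) (s n : nat) (f : 'I_s -> 'I_n)
    (A : 'M[F]_(s, n)) : ~ injective f -> \det (colsub f A) = 0.
Proof.
move=> /injectiveP/injectivePn[i [j ij fij]].
rewrite -det_tr; apply: (determinant_alternate ij) => k.
by rewrite !mxE fij.
Qed.

(** * The real spectral theorem *)

(** The reflection in the hyperplane orthogonal to e_0 - v exchanges e_0 and
    v. *)
Lemma householder (R : realType) n (v : 'rV[R]_(1 + n)) :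
  v *m v^T = 1%:M ->
  exists P : 'M[R]_(1 + n),
    P *m P^T = 1%:M /\ delta_mx 0 0 *m P = v :> 'rV_(1 + n).
Proof.
move=> v1; pose e : 'rV[R]_(1 + n) := delta_mx 0 0.
have ee : e *m e^T = 1%:M.
  by apply/matrixP => i j; rewrite trmx_delta mul_delta_mx !mxE !ord1.
have [w wE] : exists w : 'rV[R]_(1 + n), w = e - v by exists (e - v).
have ve : v *m e^T = (v 0 0)%:M.
  rewrite trmx_delta; apply/matrixP => i j; rewrite !ord1 -colE !mxE.
  by rewrite eqxx.
have ev : e *m v^T = (v 0 0)%:M.
  by rewrite -[LHS]trmxK trmx_mul trmxK ve tr_scalar_mx.
have ww : w *m w^T = (2 - 2 * v 0 0)%:M.
  rewrite wE [_^T]raddfB /= mulmxBl !mulmxBr ee ev ve v1 -!raddfB /=.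
  by congr (_ %:M); ring.
have ew : e *m w^T = (1 - v 0 0)%:M.
  by rewrite wE [_^T]raddfB /= mulmxBr ee ev -raddfB.
have [v00|v00] := eqVneq (v 0 0) 1.
  exists 1%:M; rewrite trmx1 mulmx1; split=> //; rewrite mulmx1.
  apply/eqP; rewrite -subr_eq0 -/e -wE; apply/eqP/rowP => i; rewrite [RHS]mxE.
  have /eqP : \sum_k w 0 k ^+ 2 = 0.
    transitivity ((w *m w^T) 0 0); last first.
      by rewrite ww v00 mulr1 subrr !mxE mul0rn.
    by rewrite mxE; apply: eq_bigr => k _; rewrite [w^T _ _]mxE expr2.
  rewrite psumr_eq0 => [/allP/(_ i)|k _]; last exact: sqr_ge0.
  by rewrite mem_index_enum => /(_ isT); rewrite sqrf_eq0 => /eqP.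
pose c := (1 - v 0 0)^-1; have nz : 1 - v 0 0 != 0.
  by rewrite subr_eq0 eq_sym.
exists (1%:M - c *: (w^T *m w)); split.
  have -> : (1%:M - c *: (w^T *m w))^T = 1%:M - c *: (w^T *m w).
    by rewrite [LHS]raddfB /= tr_scalar_mx linearZ /= trmx_mul trmxK.
  rewrite mulmxBl mul1mx mulmxBr mulmx1 -scalemxAl -scalemxAr.
  rewrite mulmxA -(mulmxA w^T w).
  rewrite ww scalar_mxC mul_scalar_mx -scalemxAl !scalerA.
  set a := c * _; have -> : a = c *+ 2 by rewrite /a /c; field.
  by rewrite mulr2n scalerDl opprB addrK subrK.
rewrite mulmxBr mulmx1 -scalemxAr mulmxA ew mul_scalar_mx scalerA /c mulVf //.
by rewrite scale1r wE opprB addrC subrK.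
Qed.

Lemma char_poly_orthogonal (R : realType) n (P D : 'M[R]_n) :
  P *m P^T = 1%:M -> char_poly (P^T *m D *m P) = char_poly D.
Proof.
move=> PP; have [uP _] := mulmx1_unit PP.
by rewrite -[P^T](mulKmx uP) PP mulmx1 char_poly_invmx_mul.
Qed.

(** Deflation: an eigenvector for the first root is moved to e_0 by a
    reflection, which splits off a one by one block. Carrying the roots along
    keeps the diagonal in the order of l. *)
Lemma symmetric_spectral (R : realType) n (X : 'M[R]_n) (l : 'rV[R]_n) :
  X^T = X -> char_poly X = \prod_(i < n) ('X - (l 0 i)%:P) ->
  exists P : 'M[R]_n, P *m P^T = 1%:M /\ X = P^T *m diag_mx l *m P.
Proof.
elim: n X l => [|n IHn] X l XT chX.
  by exists 0; split; apply/matrixP => -[].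
have /eigenvalueP[v vX v0] : eigenvalue X (l 0 0).
  rewrite eigenvalue_root_char rootE chX big_ord_recl hornerM hornerXsubC.
  by rewrite subrr mul0r.
pose nv := \sum_i v 0 i ^+ 2.
have nv0 : 0 < nv.
  rewrite lt_neqAle sumr_ge0 => [|i _]; last exact: sqr_ge0.
  rewrite andbT eq_sym; apply: contra v0 => /eqP nv0.
  apply/eqP/rowP => i; rewrite mxE; apply/eqP; rewrite -sqrf_eq0.
  have /psumr_eq0P/(_ nv0 i) -> // : forall i, true -> 0 <= v 0 i ^+ 2.
  by move=> j _; exact: sqr_ge0.
pose u : 'rV[R]_(1 + n) := (Num.sqrt nv)^-1 *: v.
have uu : u *m u^T = 1%:M.
  rewrite linearZ /= -scalemxAl -scalemxAr scalerA.
  have -> : v *m v^T = nv%:M.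
    apply/matrixP => i j; rewrite !ord1 !mxE mulr1n.
    by apply: eq_bigr => k _; rewrite mxE expr2.
  by rewrite scale_scalar_mx -expr2 exprVn sqr_sqrtr ?ltW // mulVf ?gt_eqF.
have uX : u *m X = l 0 0 *: u.
  by rewrite -scalemxAl vX !scalerA mulrC.
have [P [PP eP]] := householder uu.
have PtP := mulmx1C PP.
have [Y YP] : exists Y : 'M[R]_(1 + n), Y = P *m X *m P^T by eexists.
have XE : X = P^T *m Y *m P.
  by rewrite YP !mulmxA PtP mul1mx -mulmxA PtP mulmx1.
have YT : Y^T = Y by rewrite YP !trmx_mul trmxK XT mulmxA.
have eY : delta_mx 0 0 *m Y = l 0 0 *: delta_mx 0 0 :> 'rV_(1 + n).
  by rewrite YP !mulmxA eP uX -eP -!scalemxAl -mulmxA PP mulmx1.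
have Y0 j : Y 0 j = l 0 0 *+ (0 == j).
  by move/rowP/(_ j): eY; rewrite -rowE !mxE eqxx andTb mulr_natr eq_sym.
pose l1 : 'rV[R]_n := rsubmx (l : 'rV_(1 + n)).
pose Y1 : 'M[R]_n := drsubmx Y.
have YE : Y = block_mx (l 0 0)%:M 0 0 Y1.
  rewrite -[LHS]submxK; congr block_mx; apply/matrixP => i j; rewrite !mxE.
  - by rewrite !ord1 lshift0 Y0.
  - by rewrite !ord1 lshift0 Y0.
  - by rewrite -YT mxE !ord1 lshift0 Y0.
have lE : l = row_mx (l 0 0)%:M l1.
  have -> : (l 0 0)%:M = lsubmx (l : 'rV_(1 + n)).
    by apply/rowP => i; rewrite !mxE !ord1 lshift0.
  by rewrite hsubmxK.
have chY1 : char_poly Y1 = \prod_(i < n) ('X - (l1 0 i)%:P).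
  have chB : char_poly (block_mx (l 0 0)%:M 0 0 Y1 : 'M[R]_(1 + n)) =
      char_poly ((l 0 0)%:M : 'M[R]_1) * char_poly Y1.
    by rewrite /char_poly (char_block_diag_mx (l 0 0)%:M Y1) det_ublock.
  have chY : char_poly X = char_poly ((l 0 0)%:M : 'M[R]_1) * char_poly Y1.
    by rewrite -chB XE char_poly_orthogonal // YE.
  move: chY; rewrite chX big_ord_recl.
  have -> : char_poly ((l 0 0)%:M : 'M[R]_1) = 'X - (l 0 0)%:P.
    by rewrite /char_poly det_mx11 !mxE eqxx !mulr1n.
  have nz : 'X - (l 0 0)%:P != 0 :> {poly R} by rewrite polyXsubC_eq0.
  move/(mulfI nz) => <-.
  by apply: eq_bigr => i _; rewrite mxE rshift1.
have Y1T : Y1^T = Y1 by rewrite /Y1 trmx_drsub YT.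
have [P1 [PP1 Y1E]] := IHn _ _ Y1T chY1.
pose Q : 'M[R]_(1 + n) := block_mx 1%:M 0 0 P1.
have QQ : Q *m Q^T = 1%:M.
  rewrite /Q tr_block_mx mulmx_block !trmx0 !mul0mx !mulmx0 !addr0 add0r.
  by rewrite trmx1 mul1mx PP1 -scalar_mx_block.
have YQ : Y = Q^T *m diag_mx (row_mx (l 0 0)%:M l1) *m Q.
  rewrite {1}YE {1}Y1E diag_mx_row /Q tr_block_mx !mulmx_block.
  rewrite !trmx0 !mul0mx !mulmx0 !addr0 !add0r trmx1 mul1mx mulmx1 !mul0mx.
  have -> // : diag_mx (l 0 0)%:M = (l 0 0)%:M :> 'M[R]_1.
  by apply/matrixP => i j; rewrite !ord1 !mxE.
exists (Q *m P); split.
  by rewrite trmx_mul mulmxA -(mulmxA Q) PP mulmx1 QQ.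
rewrite XE trmx_mul -!mulmxA; congr (_ *m _); rewrite !mulmxA; congr (_ *m _).
by rewrite YQ -lE.
Qed.

Lemma symmetric_eigvals (R : realType) n (X : 'M[R]_n) : X^T = X ->
  exists P : 'M[R]_n, P *m P^T = 1%:M /\ X = P^T *m diag_mx (eigvals X) *m P.
Proof. by move=> XT; apply: symmetric_spectral => //; have [] := eigvalsP XT. Qed.

Lemma eigvals_nonincr (R : realType) n (X : 'M[R]_n) :
  X^T = X -> nonincr (eigvals X).
Proof. by move=> /eigvalsP[]. Qed.

(** * Determinants of Gram matrices *)

Lemma gram_diag_ge0 (R : realType) m n (A : 'M[R]_(m, n)) i :
  0 <= (A *m A^T) i i.
Proof. by rewrite mxE sumr_ge0 // => k _; rewrite mxE -expr2 sqr_ge0. Qed.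

Lemma gram_diag_eq0 (R : realType) m n (A : 'M[R]_(m, n)) i :
  (A *m A^T) i i = 0 -> forall k, A i k = 0.
Proof.
rewrite mxE => A0 k; apply/eqP; rewrite -sqrf_eq0 expr2; apply/eqP.
have /psumr_eq0P : forall j, true -> 0 <= A i j * A^T j i.
  by move=> j _; rewrite mxE -expr2 sqr_ge0.
by move/(_ A0 k isT); rewrite mxE.
Qed.

Lemma gram_sym (R : realType) m n (A : 'M[R]_(m, n)) :
  (A *m A^T)^T = A *m A^T.
Proof. by rewrite trmx_mul trmxK. Qed.

Lemma eigvals_gram_ge0 (R : realType) m n (A : 'M[R]_(m, n)) i :
  0 <= eigvals (A *m A^T) 0 i.
Proof.
have [P [PP XE]] := symmetric_eigvals (gram_sym A).
set l := eigvals _ in XE *.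
have -> : l 0 i = ((P *m A) *m (P *m A)^T) i i.
  rewrite trmx_mul mulmxA -(mulmxA P A) XE !mulmxA PP mul1mx -mulmxA PP mulmx1.
  by rewrite mxE eqxx.
exact: gram_diag_ge0.
Qed.

Lemma det_gram_le_trace (R : realType) s n (A : 'M[R]_(s, n)) :
  \det (A *m A^T) <= (\tr (A *m A^T) / s%:R) ^+ s.
Proof.
have [P [PP XE]] := symmetric_eigvals (gram_sym A).
have PtP := mulmx1C PP; have := eigvals_gram_ge0 A.
set l := eigvals _ in XE * => l_ge0.
have -> : \det (A *m A^T) = \prod_i l 0 i.
  rewrite XE !det_mulmx mulrAC -det_mulmx PtP det1 mul1r det_diag //.
have -> : \tr (A *m A^T) = \sum_i l 0 i.
  by rewrite XE mxtrace_mulC mulmxA PP mul1mx mxtrace_diag.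
have := @leif_AGM R 'I_s predT (fun i => l 0 i).
rewrite card_ord => /(_ (fun i _ => l_ge0 i)) [].
by [].
Qed.

(** Hadamard's inequality: after rescaling the rows of A to unit length, it is
    [det_gram_le_trace]. *)
Lemma det_gram_le_diag (R : realType) s n (A : 'M[R]_(s, n)) :
  \det (A *m A^T) <= \prod_i (A *m A^T) i i.
Proof.
have [/existsP[i /eqP Ai0]|] := boolP [exists i, (A *m A^T) i i == 0].
  have -> : \det (A *m A^T) = 0.
    rewrite (expand_det_row _ i) big1 // => j _.
    by rewrite mxE big1 ?mul0r // => k _; rewrite gram_diag_eq0 ?mul0r.
  by apply: prodr_ge0 => j _; exact: gram_diag_ge0.
rewrite negb_exists => /forallP A_neq0.
have A_gt0 i : 0 < (A *m A^T) i i.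
  by rewrite lt_neqAle eq_sym A_neq0 gram_diag_ge0.
pose r : 'rV[R]_s := \row_i (Num.sqrt ((A *m A^T) i i))^-1.
pose B := diag_mx r *m A.
have BB : B *m B^T = diag_mx r *m (A *m A^T) *m diag_mx r.
  by rewrite /B trmx_mul tr_diag_mx !mulmxA.
have rr i : r 0 i * r 0 i = ((A *m A^T) i i)^-1.
  by rewrite mxE -invfM -expr2 sqr_sqrtr ?ltW.
have BBii i : (B *m B^T) i i = 1.
  rewrite BB mul_mx_diag mxE mul_diag_mx mxE mulrAC rr mulVf //.
have := det_gram_le_trace B.
rewrite [\tr _](eq_bigr (fun=> 1)) // sumr_const card_ord.
have [s0|s_gt0] := posnP s.
  move=> _; move: (A) (r); rewrite s0 => A' _.
  by rewrite det_mx00 big_ord0.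
rewrite divff ?pnatr_eq0 -?lt0n // expr1n BB !det_mulmx det_diag mulrAC.
rewrite -big_split /= (eq_bigr _ (fun i _ => rr i)) prodfV.
by rewrite ler_pdivrMl ?prodr_gt0 // mulr1.
Qed.

(** * Isometries with prescribed row norms *)

(** H H^T is an orthogonal projection K, so K_aa is the sum of the K_ab^2. *)
Lemma isometry_row_orthogonal (R : realType) n s (H : 'M[R]_(n, s)) a :
  H^T *m H = 1%:M -> (H *m H^T) a a \in [:: 0; 1] ->
  forall b, b != a -> (H *m H^T) a b = 0.
Proof.
move=> HH Kaa b ba; set K := H *m H^T in Kaa *.
have KK : K a a = K a a ^+ 2 + \sum_(j | j != a) K a j ^+ 2.
  have {1}-> : K = K *m K^T.
    by rewrite gram_sym mulmxA -(mulmxA H) HH mulmx1.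
  rewrite mxE (bigD1 a) //=; congr (_ + _); first by rewrite [K^T _ _]mxE expr2.
  by apply: eq_bigr => j _; rewrite [K^T _ _]mxE expr2.
have Kaa2 : K a a ^+ 2 = K a a.
  by move: Kaa; rewrite !inE => /orP[] /eqP ->; rewrite ?expr0n ?expr1n.
have /psumr_eq0P K0 : forall j, j != a -> 0 <= K a j ^+ 2.
  by move=> j _; exact: sqr_ge0.
apply/eqP; rewrite -sqrf_eq0; apply/eqP; apply: K0 => //.
by apply: (addrI (K a a)); rewrite -{1}Kaa2 -KK addr0.
Qed.

(** A rotation of the rows a and b preserves H^T H. As these rows are
    orthogonal, their squared norms are replaced by convex combinations. *)
Lemma isometry_rotate (R : realType) n s (H : 'M[R]_(n, s)) (mu : 'I_n -> R)
    a b c e : a != b -> H^T *m H = 1%:M -> (H *m H^T) a b = 0 ->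
  c ^+ 2 + e ^+ 2 = 1 ->
  c ^+ 2 * (H *m H^T) a a + e ^+ 2 * (H *m H^T) b b = mu a ->
  (H *m H^T) a a + (H *m H^T) b b = mu a + mu b ->
  (forall i, i != a -> i != b -> (H *m H^T) i i = mu i) ->
  exists L : 'M[R]_(n, s), L^T *m L = 1%:M /\ forall i, (L *m L^T) i i = mu i.
Proof.
move=> ab HH Kab ce mua muab muE.
have ba : b != a by rewrite eq_sym.
have KE (G : 'M[R]_(n, s)) i j : (G *m G^T) i j = \sum_k G i k * G j k.
  by rewrite mxE; apply: eq_bigr => k _; rewrite mxE.
pose L : 'M[R]_(n, s) := \matrix_(i, k)
  if i == a then c * H a k + e * H b k
  else if i == b then c * H b k - e * H a k else H i k.
have La k : L a k = c * H a k + e * H b k by rewrite mxE eqxx.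
have Lb k : L b k = c * H b k - e * H a k by rewrite mxE eqxx (negPf ba).
have Li i k : i != a -> i != b -> L i k = H i k.
  by move=> /negPf ia /negPf ib; rewrite mxE ia ib.
have Laa : (L *m L^T) a a = mu a.
  rewrite -mua !KE !mulr_sumr -big_split /=.
  transitivity (\sum_k (c ^+ 2 * (H a k * H a k) + e ^+ 2 * (H b k * H b k))
      + (2 * c * e) * (H *m H^T) a b).
    rewrite KE mulr_sumr -big_split /=; apply: eq_bigr => k _.
    by rewrite La; ring.
  by rewrite Kab mulr0 addr0.
exists L; split.
  apply/matrixP => k l; rewrite -HH !mxE (bigD1 a) //= [RHS](bigD1 a) //=.
  rewrite (bigD1 b) //= [in RHS](bigD1 b) //= !addrA; congr (_ + _); last first.
    by apply: eq_bigr => i /andP[ia ib]; rewrite ![_^T _ _]mxE !Li.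
  rewrite ![_^T _ _]mxE !La !Lb -[RHS]mul1r -ce; ring.
move=> i; have [->//|ia] := eqVneq i a; have [->|ib] := eqVneq i b; last first.
  by rewrite -muE // !KE; apply: eq_bigr => k _; rewrite Li.
apply: (addrI (mu a)); rewrite -muab -{1}Laa !KE -!big_split /=.
transitivity (\sum_k (c ^+ 2 + e ^+ 2) * (H a k * H a k + H b k * H b k)).
  by apply: eq_bigr => k _; rewrite La Lb; ring.
by apply: eq_bigr => k _; rewrite ce mul1r.
Qed.

Lemma isometry_of_indicator (R : realType) n s (mu : 'I_n -> R) :
  (forall i, mu i \in [:: 0; 1]) -> \sum_i mu i = s%:R ->
  exists H : 'M[R]_(n, s), H^T *m H = 1%:M /\ forall i, (H *m H^T) i i = mu i.
Proof.
move=> mu01 mus; pose S := [set i | mu i == 1]%SET.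
have muE i : mu i = (i \in S)%:R.
  rewrite finset.inE; have := mu01 i; rewrite !inE => /orP[]/eqP ->.
    by rewrite eq_sym oner_eq0.
  by rewrite eqxx.
have cardS : #|S| = s.
  apply/eqP; rewrite -(eqr_nat R) -mus -sum1_card natr_sum big_mkcond /=.
  by apply/eqP/eq_bigr => i _; rewrite muE; case: (i \in S).
case: _ / cardS => {mus}.
exists (\matrix_(i, k) (i == enum_val k)%:R); split.
  apply/matrixP => k l; rewrite !mxE (bigD1 (enum_val k)) //= big1 => [|i ik].
    by rewrite !mxE eqxx mul1r addr0 (inj_eq enum_val_inj).
  by rewrite !mxE (negPf ik) mul0r.
move=> i; rewrite muE mxE.
have [iS|iS] := boolP (i \in S).
  rewrite (bigD1 (enum_rank_in iS i)) //= big1 => [|k ki].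
    by rewrite !mxE enum_rankK_in // eqxx mul1r addr0.
  rewrite mxE; case: eqP => [ik|]; last by rewrite mul0r.
  by case/eqP: ki; apply: enum_val_inj; rewrite enum_rankK_in.
rewrite big1 // => k _; rewrite mxE; case: eqP => [ik|]; last by rewrite mul0r.
by case/negP: iS; rewrite ik enum_valP.
Qed.

(** The Schur-Horn theorem for projections, by induction on the number of
    entries of mu outside {0, 1}. If there is one, say mu_a, there is a second
    one, mu_b, because the sum is an integer; moving mass from one to the other
    until mu_a reaches 0 or 1 gives a simpler vector, and a rotation of the two
    rows moves the mass back. *)
Lemma isometry_with_diag (R : realType) n s (mu : 'I_n -> R) :
  (forall i, 0 <= mu i <= 1) -> \sum_i mu i = s%:R ->
  exists H : 'M[R]_(n, s), H^T *m H = 1%:M /\ forall i, (H *m H^T) i i = mu i.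
Proof.
pose frac (mu : 'I_n -> R) := [set i | mu i \notin [:: 0; 1]]%SET.
have [N] := ubnP #|frac mu|; elim: N mu => // N IHN mu /ltnSE leN mu01 mus.
have [frac0|/set0Pn[a fa]] := eqVneq (frac mu) finset.set0.
  apply: isometry_of_indicator => // i.
  by have /setP/(_ i) := frac0; rewrite !inE => /negbFE.
have mua : 0 < mu a < 1.
  move: fa; rewrite !inE negb_or => /andP[a0 a1].
  by have /andP[] := mu01 a; rewrite !lt_neqAle a1 eq_sym a0 => -> ->.
have [b ba fb] : exists2 b, b != a & b \in frac mu.
  apply/exists_inP; apply: contraPT mus => /exists_inPn noB.
  have mu_ind i : i != a -> mu i = (mu i == 1)%:R.
    move=> /noB; rewrite !inE negbK => /orP[]/eqP ->; rewrite ?eqxx //.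
    by rewrite eq_sym oner_eq0.
  rewrite (bigD1 a) //= (eq_bigr _ mu_ind) -natr_sum.
  set m := (\sum_(i | _) _)%N => mus.
  have /andP[] : ((m%:R : R) < s%:R) && ((s%:R : R) < (m + 1)%:R).
    by rewrite -mus natrD; lra.
  by rewrite !ltr_nat; lia.
have mub : 0 < mu b < 1.
  move: fb; rewrite !inE negb_or => /andP[b0 b1].
  by have /andP[] := mu01 b; rewrite !lt_neqAle b1 eq_sym b0 => -> ->.
pose lo : R := if mu a + mu b <= 1 then 0 else 1.
pose nu i := if i == a then lo else if i == b then mu a + mu b - lo else mu i.
have nua : nu a = lo by rewrite /nu eqxx.
have nub : nu b = mu a + mu b - lo by rewrite /nu eqxx (negPf ba).
have nui i : i != a -> i != b -> nu i = mu i.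
  by rewrite /nu => /negPf -> /negPf ->.
have lo01 : lo \in [:: 0; 1] by rewrite /lo !inE; case: ifP; rewrite eqxx ?orbT.
have nu01 i : 0 <= nu i <= 1.
  rewrite /nu; case: eqP => [_|_]; first by rewrite /lo; case: ifP; lra.
  case: eqP => [_|_]; last exact: mu01.
  by rewrite /lo; case: (leP (mu a + mu b) 1) => ?; lra.
have nus : \sum_i nu i = s%:R.
  rewrite -mus (bigD1 a) //= [RHS](bigD1 a) //= (bigD1 b) //=.
  rewrite [in RHS](bigD1 b) //= !addrA nua nub; congr (_ + _); first ring.
  by apply: eq_bigr => i /andP[ia ib]; rewrite nui.
have frac_lt : (#|frac nu| < N)%N.
  apply: leq_trans leN; apply: proper_card; apply/properP; split; last first.
    by exists a => //; rewrite finset.inE nua lo01.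
  apply/fintype.subsetP => i; have [->//|ia] := eqVneq i a.
  by have [->//|ib] := eqVneq i b; rewrite !finset.inE nui.
have [H [HH Hnu]] := IHN _ frac_lt nu01 nus.
have Kab : (H *m H^T) a b = 0.
  by apply: isometry_row_orthogonal => //; rewrite Hnu nua.
(* The square of the cosine: the solution of
   c2 * nu_a + (1 - c2) * nu_b = mu_a in the two cases for nu_a. *)
pose c2 := if mu a + mu b <= 1 then mu b / (mu a + mu b)
           else (1 - mu b) / (2 - mu a - mu b).
have [c2_ge0 c2_le1 c2E] : [/\ 0 <= c2, 0 <= 1 - c2 &
    c2 * nu a + (1 - c2) * nu b = mu a].
  rewrite nua nub /lo /c2; case: (leP (mu a + mu b) 1) => muab.
    have t0 : 0 < mu a + mu b by lra.
    split; first by rewrite divr_ge0; lra.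
      by rewrite subr_ge0 ler_pdivrMr; lra.
    by field; rewrite gt_eqF.
  have t0 : 0 < 2 - mu a - mu b by lra.
  split; first by rewrite divr_ge0; lra.
    by rewrite subr_ge0 ler_pdivrMr; lra.
  by field; rewrite gt_eqF.
apply: (@isometry_rotate _ _ _ H mu a b (Num.sqrt c2) (Num.sqrt (1 - c2))) => //.
- by rewrite eq_sym.
- by rewrite !sqr_sqrtr // addrC subrK.
- by rewrite !sqr_sqrtr // !Hnu.
- by rewrite !Hnu nua nub addrC subrK.
- by move=> i ia ib; rewrite Hnu nui.
Qed.

(** * Majorization and water filling *)

Definition admissible {R : realType} {d : nat} (l xi : 'rV[R]_d) : Prop :=
  [/\ forall i, 0 <= xi 0 i, majorizes xi l & nonincr xi].

Definition headprod {R : realType} {d : nat} (s : nat) (xi : 'rV[R]_d) : R :=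
  \prod_(i < d | (i < s)%N) xi 0 i.

Definition headsum {R : realType} {d : nat} (j : nat) (u : 'rV[R]_d) : R :=
  \sum_(i < d | (i < j)%N) u 0 i.

Lemma topsum_nonincr (R : realType) d j (u : 'rV[R]_d) :
  nonincr u -> topsum j u = headsum j u.
Proof.
move=> u_dec; rewrite /topsum /headsum (sorted_sort ge_trans) ?nonincr_sorted //.
set r := [seq _ | _ <- _]; have rE (i : 'I_d) : u 0 i = nth 0 r i.
  by rewrite (nth_map i) ?size_enum_ord // nth_ord_enum.
have szr : size r = d by rewrite size_map size_enum_ord.
rewrite (eq_bigr _ (fun i _ => rE i)) -(big_mkord (fun i => i < j)%N (nth 0 r)).
have [jd|dj] := leqP j d.
  rewrite (big_nth 0) size_takel ?szr // (big_nat_widen _ _ d) //.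
  by apply: eq_bigr => i ij; rewrite nth_take.
rewrite take_oversize ?szr ?(ltnW dj) // (big_nth 0) szr [RHS]big_nat_cond.
rewrite [LHS]big_nat_cond; apply: eq_bigl => i; rewrite andbT.
by case: (ltnP i d) => //= /ltn_trans/(_ dj) ->.
Qed.

Lemma headsum_full (R : realType) d j (u : 'rV[R]_d) :
  (d <= j)%N -> headsum j u = \sum_i u 0 i.
Proof. by move=> dj; apply: eq_bigl => i; rewrite (leq_trans (ltn_ord i)). Qed.

Lemma majorizes_headsum (R : realType) d (u w : 'rV[R]_d) :
  nonincr u -> nonincr w ->
  majorizes u w <->
  \sum_i u 0 i = \sum_i w 0 i /\ forall j, headsum j w <= headsum j u.
Proof.
move=> u_dec w_dec; split=> -[eq_sum le_top]; split=> // j.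
  have [jd|dj] := leqP j d.-1.
    by rewrite -!topsum_nonincr // le_top.
  by rewrite !headsum_full ?eq_sum //; lia.
by move=> _; rewrite !topsum_nonincr.
Qed.

(** Summation by parts. It turns domination of the partial sums, that is
    majorization, into an inequality between weighted sums. *)
Lemma abel_sum_le (R : realType) n (a t : nat -> R) :
  (forall i j, (i <= j < n)%N -> t i <= t j) ->
  (forall j, (j <= n)%N -> 0 <= \sum_(i < j) a i) -> \sum_(i < n) a i = 0 ->
  \sum_(i < n) t i * a i <= 0.
Proof.
case: n => [|n] t_inc D_ge0 D0; first by rewrite big_ord0.
suff S m : (m <= n)%N ->
    \sum_(i < m.+1) t i * a i <= t m * \sum_(i < m.+1) a i.
  by rewrite (le_trans (S n _)) // D0 mulr0.
elim: m => [_|m IHm mn]; first by rewrite !big_ord_recr !big_ord0 /= !add0r.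
rewrite big_ord_recr [in leRHS]big_ord_recr /= mulrDr lerD2r.
apply: le_trans (IHm (ltnW mn)) _; apply: ler_wpM2r.
  by apply: D_ge0; lia.
by apply: t_inc; lia.
Qed.

(** The parameters of the optimal xi for l: it keeps the k entries of l above
    the level theta and spreads the rest of the mass evenly over the other
    s - k places. *)
Definition water_level {R : realType} {d : nat} (s k : nat) (theta : R)
    (l : 'rV[R]_d) : Prop :=
  [/\ (k < s <= d)%N, theta * (s - k)%:R = \sum_(i < d | (k <= i)%N) l 0 i,
      forall i : 'I_d, (k <= i)%N -> l 0 i <= theta &
      forall i : 'I_d, (i < k)%N -> theta <= l 0 i].

(** Written tau in the comments. The entries at places s, s + 1, ... also get
    the value theta: this is the entrywise inverse of the vector of dual
    multipliers, not the optimal xi, with which it agrees only on the first s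
    places. *)
Definition levelled {R : realType} {d : nat} (k : nat) (theta : R)
    (l : 'rV[R]_d) : 'rV[R]_d :=
  \row_i if (i < k)%N then l 0 i else theta.

(** The least k for which the average theta of the remaining mass is not
    exceeded by a remaining entry; minimality gives theta <= l_(k-1). *)
Lemma water_level_exists (R : realType) d s (l : 'rV[R]_d) :
  (0 < s <= d)%N -> nonincr l -> (forall i, 0 <= l 0 i) ->
  exists k theta, water_level s k theta l.
Proof.
move=> /andP[s_gt0 sd] l_dec l_ge0.
pose tail k := \sum_(i < d | (k <= i)%N) l 0 i.
pose good k := [forall i : 'I_d, (k <= i)%N ==> (l 0 i * (s - k)%:R <= tail k)].
have tailS (k : 'I_d) : tail k = l 0 k + tail k.+1.
  rewrite /tail (bigD1 k) //=; congr (_ + _); apply: eq_bigl => i.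
  by rewrite ltn_neqAle andbC eq_sym.
(* At k = s - 1 the whole remaining mass goes to a single place. *)
have gooda : good s.-1.
  apply/forallP => i; apply/implyP => ki; have -> : (s - s.-1)%N = 1%N by lia.
  by rewrite mulr1 /tail (bigD1 i) //= lerDl sumr_ge0.
have [k gk kmin] := ex_minnP (ex_intro good _ gooda).
have ks : (k < s)%N by have := kmin _ gooda; lia.
have sk : 0 < (s - k)%:R :> R by rewrite ltr0n subn_gt0.
exists k, (tail k / (s - k)%:R); split; first by rewrite ks.
- by rewrite divfK ?gt_eqF.
- move=> i ki; rewrite ler_pdivlMr //.
  by have /forallP/(_ i)/implyP := gk; apply.
move=> i ik; have k1d : (k.-1 < d)%N by lia.
pose o := Ordinal k1d; apply: le_trans (l_dec i o _); last by rewrite /=; lia.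
have : ~~ good k.-1 by apply/negP => /kmin; lia.
rewrite negb_forall => /existsP[j]; rewrite negb_imply -ltNge => /andP[kj].
have -> : tail k.-1 = l 0 o + tail k.
  by rewrite (tailS o) /= prednK //; lia.
have -> : (s - k.-1)%:R = (s - k)%:R + 1 :> R by rewrite natr1; congr _%:R; lia.
have jo : l 0 j <= l 0 o by exact: l_dec.
have skp : 0 < (s - k)%:R + 1 :> R by rewrite addr_gt0.
have := ler_wpM2r (ltW skp) jo => jo' lt.
rewrite ler_pdivrMr //; nra.
Qed.

Section WaterLevel.
Context (R : realType) (d s k : nat) (theta : R) (l : 'rV[R]_d).

Lemma water_level_ge0 :
  water_level s k theta l -> (forall i, 0 <= l 0 i) -> 0 <= theta.
Proof.
move=> [/andP[ks _] thetaE _ _] l_ge0.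
have sk : 0 < (s - k)%:R :> R by rewrite ltr0n subn_gt0.
by rewrite -(pmulr_lge0 _ sk) thetaE sumr_ge0.
Qed.

Lemma le_levelled i : water_level s k theta l -> l 0 i <= levelled k theta l 0 i.
Proof. by move=> [_ _ le_th _]; rewrite mxE; case: ltnP => // /le_th. Qed.

Lemma levelled_ge0 i : water_level s k theta l -> (forall i, 0 <= l 0 i) ->
  0 <= levelled k theta l 0 i.
Proof. by move=> wl l_ge0; exact: le_trans (le_levelled _ wl). Qed.

Lemma levelled_ge i : water_level s k theta l -> theta <= levelled k theta l 0 i.
Proof. by move=> [_ _ _ ge_th]; rewrite mxE; case: ltnP => // /ge_th. Qed.

Lemma sum_ord_lt_const (j : nat) (c : R) : (j <= d)%N ->
  \sum_(i < d | (i < j)%N) c = c *+ j.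
Proof.
by move=> jd; rewrite (big_ord_narrow jd) /= sumr_const card_ord.
Qed.

(** The ratios l_j / tau_j are 1 for j < k, and for j >= k they sum to
    (theta (s - k)) / theta. *)
Lemma levelled_ratio_sum : water_level s k theta l -> 0 < theta ->
  \sum_i l 0 i / levelled k theta l 0 i = s%:R.
Proof.
move=> [/andP[ks sd] thetaE _ ge_th] th_gt0.
rewrite (bigID (fun i : 'I_d => i < k)%N) /=.
rewrite (eq_bigr (fun=> 1)) => [|i ik]; last first.
  by rewrite mxE ik divff // gt_eqF // (lt_le_trans th_gt0) // ge_th.
rewrite sum_ord_lt_const; last by lia.
rewrite (eq_bigr (fun i => l 0 i / theta)) => [|i ik]; last first.
  by rewrite mxE (negPf ik).
rewrite -mulr_suml (eq_bigl (fun i : 'I_d => k <= i)%N) => [|i]; last first.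
  by rewrite -leqNgt.
by rewrite -thetaE mulrAC divff ?gt_eqF // mul1r -natrD subnKC // ltnW.
Qed.

(** For theta = 0 the ratios at j >= k are 0 / 0 = 0, and only the first k
    ones remain. *)
Lemma levelled_ratio_sum_le : water_level s k theta l -> (forall i, 0 <= l 0 i) ->
  \sum_i l 0 i / levelled k theta l 0 i <= s%:R.
Proof.
move=> wl l_ge0; have := water_level_ge0 wl l_ge0; rewrite le_eqVlt.
move=> /predU1P[th0|th_gt0]; last by rewrite levelled_ratio_sum.
have [/andP[ks sd] _ _ _] := wl.
apply: (@le_trans _ _ (\sum_(i < d | (i < s)%N) 1)); last first.
  by rewrite sum_ord_lt_const.
rewrite [leRHS]big_mkcond; apply: ler_sum => i _; rewrite mxE -th0.
have [ik|ki] := ltnP i k; last by rewrite invr0 mulr0; case: ifP.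
rewrite (ltn_trans ik ks).
have [->|li0] := eqVneq (l 0 i) 0; first by rewrite mul0r.
by rewrite divff.
Qed.

Lemma headprod_levelled0 : water_level s k theta l -> theta = 0 ->
  headprod s (levelled k theta l) = 0.
Proof.
move=> [/andP[ks sd] _ _ _] th0; have kd := leq_trans ks sd.
by rewrite /headprod (bigD1 (Ordinal kd)) //= mxE /= ltnn th0 mul0r.
Qed.

Lemma prod_injective_le_prod (f : 'I_s -> 'I_d) (w : 'I_d -> R) :
  injective f -> (forall j, 1 <= w j) ->
  \prod_i w (f i) <= \prod_j w j.
Proof.
move=> f_inj w_ge1.
rewrite -(big_imset w) /=; last by move=> i j _ _; exact: f_inj.
rewrite [leRHS](bigID (mem (f @: 'I_s)%SET)) /= ler_peMr //.
  by apply: prodr_ge0 => i _; exact: le_trans (w_ge1 i).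
elim/big_ind: _ => // x y x1 y1.
by rewrite (le_trans x1) // ler_peMr // (le_trans ler01).
Qed.

Lemma prod_injective_eq_prod (f : 'I_s -> 'I_d) (w : 'I_d -> R) :
  injective f -> (forall j, w j != 1 -> exists i, f i = j) ->
  \prod_i w (f i) = \prod_j w j.
Proof.
move=> f_inj wf.
rewrite -(big_imset w) /=; last by move=> i j _ _; exact: f_inj.
rewrite [RHS](bigID (mem (f @: 'I_s)%SET)) /= [X in _ * X]big1 ?mulr1 //.
move=> j; apply: contraNeq => /wf[i <-]; exact: imset_f.
Qed.

Lemma headprodE (u : 'rV[R]_d) (sd : (s <= d)%N) :
  headprod s u = \prod_(i < s) u 0 (widen_ord sd i).
Proof. exact: (big_ord_narrow sd). Qed.

Lemma headprod_levelled : water_level s k theta l -> 0 < theta ->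
  headprod s (levelled k theta l) =
  theta ^+ s * \prod_j (levelled k theta l 0 j / theta).
Proof.
move=> [/andP[ks sd] _ _ _] th_gt0; rewrite (headprodE _ sd).
rewrite -(@prod_injective_eq_prod (widen_ord sd)) => [||j].
- rewrite big_split /= prodr_const card_ord exprVn mulrCA divff ?mulr1 //.
  by rewrite expf_neq0 // gt_eqF.
- by move=> i j /(congr1 val) /= ij; exact: val_inj.
rewrite mxE; case: ltnP => [jk _|_]; last by rewrite divff ?eqxx ?gt_eqF.
by exists (Ordinal (ltn_trans jk ks)); exact: val_inj.
Qed.

Lemma prod_injective_levelled (f : 'I_s -> 'I_d) : 0 < theta ->
  \prod_i levelled k theta l 0 (f i) =
  theta ^+ s * \prod_i (levelled k theta l 0 (f i) / theta).
Proof.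
move=> th_gt0; rewrite big_split /= prodr_const card_ord exprVn mulrCA.
rewrite divff ?mulr1 //.
by rewrite expf_neq0 // gt_eqF.
Qed.

(** Divided by theta, all entries of tau are at least 1 and those at places
    j >= k are 1, so the full product of the quotients dominates the product
    over any s distinct places and is attained by the first s ones. *)
Lemma prod_injective_le_headprod (f : 'I_s -> 'I_d) :
  water_level s k theta l -> (forall i, 0 <= l 0 i) -> injective f ->
  \prod_i levelled k theta l 0 (f i) <= headprod s (levelled k theta l).
Proof.
move=> wl l_ge0 f_inj; have := water_level_ge0 wl l_ge0; rewrite le_eqVlt.
move=> /predU1P[th0|th_gt0].
  rewrite headprod_levelled0 //; have [/andP[ks sd] _ _ _] := wl.
  (* Pigeonhole: s > k distinct places cannot all be below k. *)
  have [i kfi] : exists i, (k <= f i)%N.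
    apply/existsP; apply: contraTT ks; rewrite negb_exists => /forallP fk.
    have fk' i : (f i < k)%N by have := fk i; rewrite -ltnNge.
    rewrite -leqNgt -{1}(card_ord s) -[leqRHS](card_ord k).
    apply: (@leq_card _ _ (fun i => Ordinal (fk' i))) => i j [] eqf.
    exact/f_inj/val_inj.
  by rewrite (bigD1 i) //= mxE ltnNge kfi /= -th0 mul0r.
rewrite headprod_levelled // prod_injective_levelled //.
apply: ler_wpM2l; first by rewrite exprn_ge0 ?ltW.
apply: (@prod_injective_le_prod f (fun j => levelled k theta l 0 j / theta)) => // j.
by rewrite ler_pdivlMr // mul1r levelled_ge.
Qed.

Lemma prod_injective_eq_headprod (f : 'I_s -> 'I_d) :
  water_level s k theta l -> 0 < theta -> injective f ->
  (forall j : 'I_d, (j < k)%N -> exists i, f i = j) ->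
  \prod_i levelled k theta l 0 (f i) = headprod s (levelled k theta l).
Proof.
move=> wl th_gt0 f_inj fk; rewrite headprod_levelled // prod_injective_levelled //.
congr (_ * _).
apply: (@prod_injective_eq_prod f (fun j => levelled k theta l 0 j / theta)) => // j.
rewrite mxE; case: ltnP => [jk _|_]; first exact: fk.
by rewrite divff ?eqxx ?gt_eqF.
Qed.

Lemma levelled_nonincr :
  nonincr l -> water_level s k theta l -> nonincr (levelled k theta l).
Proof.
move=> l_dec [_ _ _ ge_th] i j ij; rewrite !mxE; case: (ltnP j k) => [jk|kj].
  by rewrite (leq_ltn_trans ij jk) l_dec.
by case: ltnP => // /ge_th.
Qed.

(** The truncation of tau to its first s places is admissible. *)
Lemma headprod_levelled_attained :
  nonincr l -> (forall i, 0 <= l 0 i) -> water_level s k theta l ->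
  exists2 xi, admissible l xi & headprod s xi = headprod s (levelled k theta l).
Proof.
move=> l_dec l_ge0 wl; set tau := levelled k theta l.
have th_ge0 := water_level_ge0 wl l_ge0.
have [/andP[ks sd] thetaE le_th ge_th] := wl.
pose xi : 'rV[R]_d := \row_i if (i < s)%N then tau 0 i else 0.
have tau_dec : nonincr tau := levelled_nonincr l_dec wl.
have xi_ge0 i : 0 <= xi 0 i.
  by rewrite mxE; case: ifP => // _; exact: levelled_ge0.
have xi_dec : nonincr xi.
  move=> i j ij; rewrite [xi 0 j]mxE; case: (ltnP j s) => // js.
  by rewrite [xi 0 i]mxE (leq_ltn_trans ij js) tau_dec.
exists xi; last by apply: eq_bigr => i is_; rewrite mxE is_.
have sum_xi : \sum_i xi 0 i = \sum_i l 0 i.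
  rewrite (bigID (fun i : 'I_d => i < k)%N).
  rewrite [RHS](bigID (fun i : 'I_d => i < k)%N) /=; congr (_ + _).
    by apply: eq_bigr => i ik; rewrite !mxE ik (ltn_trans ik ks).
  rewrite [RHS](eq_bigl (fun i : 'I_d => k <= i)%N) => [|i]; last first.
    by rewrite -leqNgt.
  have : \sum_(i < d | (i < s)%N) theta = \sum_(i < d | (i < k)%N) theta +
      \sum_(i < d | ~~ (i < k)%N) (if (i < s)%N then theta else 0).
    rewrite big_mkcond (bigID (fun i : 'I_d => i < k)%N) /=; congr (_ + _).
    by apply: eq_bigr => i ik; rewrite (ltn_trans ik ks).
  rewrite !sum_ord_lt_const ?(leq_trans (ltnW ks)) // -thetaE => sumE.
  rewrite natrB ?(ltnW ks) // mulrBr !mulr_natr sumE addrAC subrr add0r.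
  by apply: eq_bigr => i ik; rewrite !mxE (negPf ik).
split=> //; apply/majorizes_headsum => //; split=> // j.
rewrite -subr_ge0; have [js|sj] := leqP j s.
  rewrite /headsum -sumrB sumr_ge0 // => i ij.
  by rewrite mxE (leq_trans ij js) subr_ge0 le_levelled.
have {}sum_xi : headsum j xi - headsum j l =
    \sum_(i < d | ~~ (i < j)%N) (l 0 i - xi 0 i).
  move: sum_xi; rewrite (bigID (fun i : 'I_d => i < j)%N).
  rewrite [RHS](bigID (fun i : 'I_d => i < j)%N) /= sumrB.
  rewrite -/(headsum j _) -/(headsum j _).
  by lra.
rewrite sum_xi sumr_ge0 // => i; rewrite -leqNgt => ji; rewrite mxE ltnNge.
by rewrite (leq_trans (ltnW sj)) //= subr0.
Qed.

(** Weak duality. The weights 1 / tau_i are nondecreasing, so majorization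
    gives sum xi_i / tau_i <= sum l_i / tau_i = s, and the inequality of
    arithmetic and geometric means applies to the first s ratios. *)
Lemma headprod_le_levelled (xi : 'rV[R]_d) :
  nonincr l -> (forall i, 0 <= l 0 i) -> water_level s k theta l ->
  admissible l xi -> headprod s xi <= headprod s (levelled k theta l).
Proof.
move=> l_dec l_ge0 wl [xi_ge0 maj xi_dec]; set tau := levelled k theta l.
have [/andP[ks sd] thetaE le_th ge_th] := wl.
have /(majorizes_headsum xi_dec l_dec)[eq_sum le_head] := maj.
have := water_level_ge0 wl l_ge0; rewrite le_eqVlt => /predU1P[th0|th_gt0].
  rewrite headprod_levelled0 //; have kd := leq_trans ks sd; pose o := Ordinal kd.
  suff xi0 : xi 0 o = 0 by rewrite /headprod (bigD1 o) //= xi0 mul0r.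
  have tail0 : \sum_(i < d | ~~ (i < k)%N) xi 0 i <= 0.
    have := le_head k; move: eq_sum; rewrite (bigID (fun i : 'I_d => i < k)%N) /=.
    rewrite [RHS](bigID (fun i : 'I_d => i < k)%N) /= -/(headsum k _) -/(headsum k _).
    rewrite [X in _ = _ + X](eq_bigl (fun i : 'I_d => k <= i)%N) => [|i];
      last by rewrite -leqNgt.
    by rewrite -thetaE -th0 mul0r; lra.
  apply/eqP; rewrite eq_le xi_ge0 andbT (le_trans _ tail0) //.
  by rewrite (bigD1 o) /= ?ltnn // lerDl sumr_ge0.
have tau_gt0 i : 0 < tau 0 i by rewrite (lt_le_trans th_gt0) // levelled_ge.
have ratio_sum : \sum_i xi 0 i / tau 0 i <= s%:R.
  rewrite -(levelled_ratio_sum wl th_gt0) -/tau -subr_le0 -sumrB.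
  pose row_nth (u : 'rV[R]_d) n := nth 0 [seq u 0 i | i <- enum 'I_d] n.
  have rowE u (i : 'I_d) : row_nth u i = u 0 i.
    by rewrite /row_nth (nth_map i) ?size_enum_ord // nth_ord_enum.
  pose a n := row_nth (xi - l) n; pose t n := (row_nth tau n)^-1.
  have -> : \sum_i (xi 0 i / tau 0 i - l 0 i / tau 0 i) = \sum_(i < d) t i * a i.
    by apply: eq_bigr => i _; rewrite /t /a !rowE !mxE -mulrBl mulrC.
  have sum_a j : (j <= d)%N -> \sum_(i < j) a i = headsum j xi - headsum j l.
    move=> jd; rewrite /headsum -sumrB (big_ord_narrow jd) /=.
    apply: eq_bigr => i _.
    by rewrite -[LHS]/(row_nth (xi - l) (widen_ord jd i)) rowE !mxE.
  apply: abel_sum_le => [i j /andP[ij jd]|j jd|].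
  - have id := leq_ltn_trans ij jd.
    have -> : t i = (tau 0 (Ordinal id))^-1 by rewrite -rowE.
    have -> : t j = (tau 0 (Ordinal jd))^-1 by rewrite -rowE.
    by rewrite lef_pV2 ?posrE //; exact: levelled_nonincr.
  - by rewrite sum_a // subr_ge0.
  - by rewrite sum_a // !headsum_full // eq_sum subrr.
have head_ratio :
    \sum_(i < s) xi 0 (widen_ord sd i) / tau 0 (widen_ord sd i) <= s%:R.
  apply: le_trans ratio_sum; rewrite [leRHS](bigID (fun i : 'I_d => i < s)%N) /=.
  rewrite (big_ord_narrow sd) lerDl sumr_ge0 // => i _.
  by rewrite divr_ge0 // ltW.
have ratio_ge0 (i : 'I_s) : 0 <= xi 0 (widen_ord sd i) / tau 0 (widen_ord sd i).
  by rewrite divr_ge0 // ltW.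
have := @leif_AGM R 'I_s predT
  (fun i => xi 0 (widen_ord sd i) / tau 0 (widen_ord sd i)).
rewrite card_ord => /(_ (fun i _ => ratio_ge0 i)) [agm _].
have {agm} :
    \prod_(i < s) (xi 0 (widen_ord sd i) / tau 0 (widen_ord sd i)) <= 1.
  apply: le_trans agm _; apply: exprn_ile1.
    by rewrite divr_ge0 ?sumr_ge0.
  by rewrite ler_pdivrMr ?mul1r // ltr0n; lia.
rewrite !(headprodE _ sd) prodf_div ler_pdivrMr ?mul1r //.
by apply: prodr_gt0.
Qed.
End WaterLevel.

(** * Weighted sums of principal minors *)

(** The source of all polynomial expansions below: a principal minor of
    B Diag(y) B^T is a polynomial in y with squares as coefficients. *)
Lemma fact_mul_minor (R : realType) (m n s : nat) (B : 'M[R]_(m, n))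
    (y : 'rV[R]_n) (f : 'I_s -> 'I_m) :
  (s`!)%:R * \det (mxsub f f (B *m diag_mx y *m B^T)) =
  \sum_(h : {ffun 'I_s -> 'I_n}) (\prod_i y 0 (h i)) * \det (mxsub f h B) ^+ 2.
Proof.
have -> : mxsub f f (B *m diag_mx y *m B^T) =
    rowsub f B *m (diag_mx y *m (rowsub f B)^T).
  apply/matrixP => i j; rewrite mulmxA !mxE; apply: eq_bigr => k _.
  by rewrite !mul_mx_diag !mxE.
rewrite fact_mul_det_mulmx; apply: eq_bigr => h _.
have -> : rowsub h (diag_mx y *m (rowsub f B)^T) =
    diag_mx (\row_i y 0 (h i)) *m (mxsub f h B)^T.
  by apply/matrixP => i j; rewrite [LHS]mxE !mul_diag_mx !mxE.
have -> : colsub h (rowsub f B) = mxsub f h B by apply/matrixP => i j; rewrite !mxE.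
rewrite det_mulmx det_tr det_diag mulrCA expr2; congr (_ * _).
by apply: eq_bigr => i _; rewrite mxE.
Qed.

Lemma natr_fact_gt0 (R : realType) n : 0 < (n`!)%:R :> R.
Proof. by rewrite ltr0n fact_gt0. Qed.

Lemma det_mxsub_ninj (R : realType) (m n s : nat) (B : 'M[R]_(m, n))
    (f : 'I_s -> 'I_m) (h : 'I_s -> 'I_n) :
  ~ injective h -> \det (mxsub f h B) = 0.
Proof.
move=> ninj; rewrite -(det_colsub_ninj (rowsub f B) ninj).
by congr (\det _); apply/matrixP => i j; rewrite !mxE.
Qed.

Lemma diag_mx_sqrt_gram (R : realType) (m n : nat) (B : 'M[R]_(m, n))
    (y : 'rV[R]_n) :
  (forall i, 0 <= y 0 i) ->
  B *m diag_mx y *m B^T = (B *m diag_mx (\row_i Num.sqrt (y 0 i))) *m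
                          (B *m diag_mx (\row_i Num.sqrt (y 0 i)))^T.
Proof.
move=> y_ge0; rewrite trmx_mul tr_diag_mx mulmxA.
rewrite -(mulmxA B (diag_mx _) (diag_mx _)); congr (_ *m _ *m _).
by apply/matrixP => i j; rewrite mul_diag_mx !mxE mulrnAr -expr2 sqr_sqrtr //.
Qed.

Lemma eigvals_weighted_gram_ge0 (R : realType) (m n : nat) (B : 'M[R]_(m, n))
    (y : 'rV[R]_n) i : (forall i, 0 <= y 0 i) ->
  0 <= eigvals (B *m diag_mx y *m B^T) 0 i.
Proof. by move=> y_ge0; rewrite diag_mx_sqrt_gram // eigvals_gram_ge0. Qed.

Lemma eigvals_weighted_gram_nonincr (R : realType) (m n : nat)
    (B : 'M[R]_(m, n)) (y : 'rV[R]_n) :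
  nonincr (eigvals (B *m diag_mx y *m B^T)).
Proof.
by apply: eigvals_nonincr; rewrite !trmx_mul trmxK tr_diag_mx mulmxA.
Qed.

(** The weights c for which the form sum_f c_f prod_i nu_(f i) obeys the same
    bound as a product of s factors. *)
Definition am_gm_weight {R : realType} {d s : nat}
    (c : {ffun 'I_s -> 'I_d} -> R) : Prop :=
  (forall f, 0 <= c f) /\
  forall nu : 'I_d -> R, (forall i, 0 <= nu i) ->
    \sum_f c f * \prod_i nu (f i) <= ((\sum_i nu i) / s%:R) ^+ s.

(** With the spectrum of A A^T factored as l = mu tau, Cauchy-Binet in an
    eigenbasis and [prod_injective_le_headprod] bound each minor by
    prod tau_i (i < s) times the minor of N = P^T Diag(mu) P, hence, by
    Hadamard, times a product of diagonal entries of N. The bound on c applies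
    to these, because N has trace sum mu_i <= s. *)
Lemma minor_sum_le_headprod (R : realType) (d s k n : nat) (theta : R)
    (c : {ffun 'I_s -> 'I_d} -> R) (A : 'M[R]_(d, n)) :
  am_gm_weight c -> water_level s k theta (eigvals (A *m A^T)) ->
  \sum_f c f * \det (mxsub f f (A *m A^T)) <=
  headprod s (levelled k theta (eigvals (A *m A^T))).
Proof.
move=> [c_ge0 c_agm] wl; have l_ge0 := eigvals_gram_ge0 A.
have [P [PP ME]] := symmetric_eigvals (gram_sym A).
set l := eigvals _ in wl l_ge0 ME *; set tau := levelled k theta l.
have s_gt0 : (0 < s)%N by have [/andP[ks _] _ _ _] := wl; exact: leq_ltn_trans ks.
have tau_ge0 i : 0 <= tau 0 i := levelled_ge0 i wl l_ge0.
have hp_ge0 : 0 <= headprod s tau by apply: prodr_ge0.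
pose mu : 'rV[R]_d := \row_i (l 0 i / tau 0 i).
have mu_ge0 i : 0 <= mu 0 i by rewrite mxE divr_ge0.
(* Where tau vanishes so does l, and the division by zero is harmless. *)
have l_mu i : l 0 i = mu 0 i * tau 0 i.
  rewrite [mu 0 i]mxE; have [t0|t0] := eqVneq (tau 0 i) 0; last by rewrite divfK.
  rewrite t0 mulr0; apply/eqP; rewrite eq_le l_ge0 andbT -t0.
  exact: le_levelled i wl.
pose N := P^T *m diag_mx mu *m P.
have NE : N = P^T *m diag_mx mu *m P^T^T by rewrite trmxK.
have ME' : A *m A^T = P^T *m diag_mx l *m P^T^T by rewrite trmxK.
have minor_le (f : {ffun 'I_s -> 'I_d}) :
    \det (mxsub f f (A *m A^T)) <= headprod s tau * \prod_i N (f i) (f i).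
  apply: (@le_trans _ _ (headprod s tau * \det (mxsub f f N))); last first.
    apply: ler_wpM2l => //; rewrite NE diag_mx_sqrt_gram //.
    set Z := P^T *m _.
    have -> : mxsub f f (Z *m Z^T) = rowsub f Z *m (rowsub f Z)^T.
      by apply/matrixP => i j; rewrite !mxE; apply: eq_bigr => r _; rewrite !mxE.
    apply: le_trans (det_gram_le_diag _) _.
    apply: ler_prod => i _; rewrite gram_diag_ge0 /=.
    by rewrite !mxE; apply: ler_sum => r _; rewrite !mxE.
  rewrite -(ler_pM2l (natr_fact_gt0 R s)) mulrCA ME' NE !fact_mul_minor.
  rewrite mulr_sumr; apply: ler_sum => h _; rewrite [leRHS]mulrA.
  have [h_inj|/injectiveP h_ninj] := boolP (injectiveb h); last first.
    by rewrite (det_mxsub_ninj _ _ h_ninj) expr0n !mulr0.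
  apply: ler_wpM2r; first exact: sqr_ge0.
  rewrite (eq_bigr _ (fun i _ => l_mu (h i))) big_split /=.
  rewrite [leRHS]mulrC; apply: ler_wpM2l; first by apply: prodr_ge0.
  by apply: prod_injective_le_headprod => //; exact/injectiveP.
apply: (@le_trans _ _ (headprod s tau * \sum_f c f * \prod_i N (f i) (f i))).
  rewrite mulr_sumr; apply: ler_sum => f _; rewrite mulrCA.
  by apply: ler_wpM2l.
rewrite -[leRHS]mulr1; apply: ler_wpM2l => //.
apply: le_trans (c_agm (fun i => N i i) _) _ => [i|].
  by rewrite NE diag_mx_sqrt_gram // gram_diag_ge0.
have -> : \sum_i N i i = \sum_i mu 0 i.
  by rewrite -[LHS]/(\tr N) /N mxtrace_mulC mulmxA PP mul1mx mxtrace_diag.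
apply: exprn_ile1; first by rewrite divr_ge0 ?sumr_ge0.
rewrite ler_pdivrMr ?ltr0n // mul1r.
rewrite (eq_bigr (fun i => l 0 i / tau 0 i)) => [|i _]; last by rewrite mxE.
exact: levelled_ratio_sum_le.
Qed.

(** For H with squared row norms mu, the factor 1 / prod mu_(f i) normalizes
    the rows of H to unit vectors. *)
Definition frame_weight {R : realType} {d s : nat} (H : 'M[R]_(d, s))
    (f : {ffun 'I_s -> 'I_d}) : R :=
  \det (rowsub f H) ^+ 2 / ((s`!)%:R * \prod_i (H *m H^T) (f i) (f i)).

Lemma sum_det_rowsub_sqr (R : realType) (d s : nat) (H : 'M[R]_(d, s))
    (w : 'rV[R]_d) :
  \sum_(f : {ffun 'I_s -> 'I_d}) (\prod_i w 0 (f i)) * \det (rowsub f H) ^+ 2 =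
  (s`!)%:R * \det (H^T *m diag_mx w *m H).
Proof.
have := fact_mul_minor H^T w id.
have -> : mxsub id id (H^T *m diag_mx w *m H^T^T) = H^T *m diag_mx w *m H.
  by rewrite trmxK; apply/matrixP => i j; rewrite mxE.
move=> ->; apply: eq_bigr => f _; congr (_ * _ ^+ 2); rewrite -det_tr.
by congr (\det _); apply/matrixP => i j; rewrite !mxE.
Qed.

(** The form is det (H^T Diag(nu / mu) H), the determinant of a Gram matrix
    with trace at most sum nu_i. *)
Lemma frame_weight_am_gm (R : realType) (d s : nat) (H : 'M[R]_(d, s)) :
  am_gm_weight (frame_weight H).
Proof.
split=> [f|nu nu_ge0].
  rewrite divr_ge0 ?sqr_ge0 // mulr_ge0 ?prodr_ge0 ?ltW ?natr_fact_gt0 // => i _.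
  exact: gram_diag_ge0.
pose w : 'rV[R]_d := \row_j (nu j / (H *m H^T) j j).
have w_ge0 i : 0 <= w 0 i by rewrite mxE divr_ge0 ?gram_diag_ge0.
have -> : \sum_f frame_weight H f * \prod_i nu (f i) =
    \det (H^T *m diag_mx w *m H).
  apply: (mulfI (lt0r_neq0 (natr_fact_gt0 R s))).
  rewrite -sum_det_rowsub_sqr mulr_sumr; apply: eq_bigr => f _.
  rewrite [\prod_i w _ _](eq_bigr (fun i => nu (f i) / (H *m H^T) (f i) (f i)))
    => [|i _]; last by rewrite [w _ _]mxE.
  rewrite prodf_div /frame_weight invfM.
  set q := \det _ ^+ 2; set a := \prod_i nu _; set b := (\prod_i _)^-1.
  by have F0 := lt0r_neq0 (natr_fact_gt0 R s); field.
rewrite -{2}(trmxK H) diag_mx_sqrt_gram //.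
apply: le_trans (det_gram_le_trace _) _.
rewrite -diag_mx_sqrt_gram // trmxK.
have -> : \tr (H^T *m diag_mx w *m H) = \sum_i w 0 i * (H *m H^T) i i.
  rewrite mxtrace_mulC mulmxA; apply: eq_bigr => i _.
  by rewrite mul_mx_diag mxE mulrC.
apply: lerXn2r; rewrite ?nnegrE.
- by rewrite divr_ge0 ?sumr_ge0 // => i _; rewrite mulr_ge0 ?gram_diag_ge0.
- by rewrite divr_ge0 ?sumr_ge0.
rewrite ler_wpM2r ?invr_ge0 ?ler0n //; apply: ler_sum => i _; rewrite [w _ _]mxE.
have [->|K0] := eqVneq ((H *m H^T) i i) 0; first by rewrite mulr0.
by rewrite divfK.
Qed.

(** A row of unit length is orthogonal to all other rows of an isometry, hence
    in the kernel of every square submatrix that omits it. *)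
Lemma row_unit_det_rowsub_eq0 (R : realType) (d s : nat) (H : 'M[R]_(d, s)) j
    (f : 'I_s -> 'I_d) :
  H^T *m H = 1%:M -> (H *m H^T) j j = 1 -> (forall i, f i <> j) ->
  \det (rowsub f H) = 0.
Proof.
move=> HH Kjj fj; apply/eqP; rewrite -det_tr; apply/det0P; exists (row j H).
  apply: contra_eq_neq Kjj => /rowP H0.
  rewrite mxE big1 ?[0 == 1]eq_sym ?oner_eq0 // => k _.
  by have := H0 k; rewrite !mxE => ->; rewrite mul0r.
apply/rowP => i; have fij : f i != j by apply/eqP/fj.
transitivity ((H *m H^T) j (f i)).
  by rewrite !mxE; apply: eq_bigr => k _; rewrite !mxE.
by rewrite [RHS]mxE (isometry_row_orthogonal HH _ fij) // Kjj !inE eqxx orbT.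
Qed.

(** * Multiaffine minorants *)

Definition multiaffine {R : realType} {d : nat} (q : {set 'I_d} -> R)
    (y : 'rV[R]_d) : R :=
  \sum_(S : {set 'I_d}) q S * \prod_(j in S) y 0 j.

(** Membership in this set means that q lies below y |-> E(F(y)) on the
    orthant. Stating it through the upper bounds b makes each condition a
    closed half-space in q. *)
Definition minorant {R : realType} {d : nat} (s : nat) (V : 'M[R]_d)
    (q : {set 'I_d} -> R) : Prop :=
  [/\ forall S, 0 <= q S, forall S : {set 'I_d}, #|S| != s -> q S = 0 &
  forall (y : 'rV[R]_d) (b : R), (forall i, 0 <= y 0 i) ->
    (forall xi, admissible (eigvals (V *m diag_mx y *m V^T)) xi ->
       headprod s xi <= b) ->
    multiaffine q y <= b].

Lemma eigvals_orthogonal (R : realType) n (P X : 'M[R]_n) :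
  P *m P^T = 1%:M -> eigvals (P *m X *m P^T) = eigvals X.
Proof.
move=> PP; have PtP : P^T *m P^T^T = 1%:M by rewrite trmxK mulmx1C.
have chP := char_poly_orthogonal X PtP; rewrite trmxK in chP.
rewrite /eigvals; congr (xget 0 _).
by apply/seteqP; split=> l [l_dec lP]; split; rewrite // ?chP // -chP.
Qed.

Lemma multiaffine_of_injections (R : realType) (d s : nat)
    (w : {ffun 'I_s -> 'I_d} -> R) :
  (forall f, 0 <= w f) ->
  (forall f : {ffun 'I_s -> 'I_d}, ~ injective f -> w f = 0) ->
  exists q : {set 'I_d} -> R,
    [/\ forall S, 0 <= q S, forall S : {set 'I_d}, #|S| != s -> q S = 0 &
        forall y, multiaffine q y = \sum_f w f * \prod_i y 0 (f i)].
Proof.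
move=> w_ge0 w_ninj.
pose im (f : {ffun 'I_s -> 'I_d}) : {set 'I_d} := (f @: 'I_s)%SET.
exists (fun S => \sum_(f | im f == S) w f); split=> [S|S cardS|y].
- by apply: sumr_ge0.
- apply: big1 => f /eqP imf; apply: w_ninj => f_inj; case/eqP: cardS.
  by rewrite -imf card_imset // card_ord.
rewrite (partition_big im xpredT) //=; apply: eq_bigr => S _.
rewrite mulr_suml; apply: eq_bigr => f /eqP imf.
have [f_inj|/injectiveP f_ninj] := boolP (injectiveb f); last first.
  by rewrite w_ninj // !mul0r.
congr (_ * _); rewrite -imf /im (big_imset (fun j => y 0 j)) //=.
by move=> i j _ _; exact/injectiveP.
Qed.

Lemma minorant0 (R : realType) (d s : nat) (V : 'M[R]_d) :
  (0 < s <= d)%N -> minorant s V (fun=> 0).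
Proof.
move=> sd; split=> // y b y_ge0 le_b.
rewrite /multiaffine big1 => [|S _]; last by rewrite mul0r.
set X := _ *m V^T in le_b.
have l_ge0 i : 0 <= eigvals X 0 i by exact: eigvals_weighted_gram_ge0.
have l_dec : nonincr (eigvals X) by exact: eigvals_weighted_gram_nonincr.
apply: le_trans (le_b (eigvals X) _); first by apply: prodr_ge0.
by split.
Qed.

Lemma minorant_attained (R : realType) (d s : nat) (V : 'M[R]_d)
    (q : {set 'I_d} -> R) (y : 'rV[R]_d) :
  (0 < s <= d)%N -> minorant s V q -> (forall i, 0 <= y 0 i) ->
  exists2 xi, admissible (eigvals (V *m diag_mx y *m V^T)) xi &
    multiaffine q y <= headprod s xi.
Proof.
move=> sd [_ _ q_le] y_ge0.
have {q_le} := q_le y _ y_ge0; set X := _ *m V^T => q_le.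
have l_ge0 i : 0 <= eigvals X 0 i by exact: eigvals_weighted_gram_ge0.
have l_dec : nonincr (eigvals X) by exact: eigvals_weighted_gram_nonincr.
have [k [theta wl]] := water_level_exists sd l_dec l_ge0.
have [xi xi_adm xi_hp] := headprod_levelled_attained l_dec l_ge0 wl.
exists xi => //; rewrite xi_hp; apply: q_le => xi' xi'_adm.
exact: headprod_le_levelled.
Qed.

(** The function Q of the introductory comment, written in the eigenbasis P
    of F(x); c and w are its weights before and after the expansion of the
    minors in y. *)
Lemma minorant_touching (R : realType) (d s : nat) (V : 'M[R]_d)
    (x xi : 'rV[R]_d) :
  (0 < s <= d)%N -> (forall i, 0 <= x 0 i) ->
  admissible (eigvals (V *m diag_mx x *m V^T)) xi ->
  exists2 q, minorant s V q & headprod s xi <= multiaffine q x.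
Proof.
move=> sd x_ge0 adm.
pose F (y : 'rV[R]_d) := V *m diag_mx y *m V^T.
have F_sym y : (F y)^T = F y.
  by rewrite /F !trmx_mul trmxK tr_diag_mx mulmxA.
have F_dec y : nonincr (eigvals (F y)) by exact: eigvals_weighted_gram_nonincr.
have F_ge0 (y : 'rV[R]_d) (y_ge0 : forall i, 0 <= y 0 i) i :
    0 <= eigvals (F y) 0 i by exact: eigvals_weighted_gram_ge0.
have [P [PP FE]] := symmetric_eigvals (F_sym x).
have PtP := mulmx1C PP.
have l_ge0 := F_ge0 x x_ge0; have l_dec := F_dec x.
set l := eigvals (F x) in FE l_ge0 l_dec; rewrite -/(F x) -/l in adm.
have [k [theta wl]] := water_level_exists sd l_dec l_ge0.
(* If theta = 0, then E(F(x)) = 0 and the zero polynomial touches. *)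
have := water_level_ge0 wl l_ge0; rewrite le_eqVlt => /predU1P[th0|th_gt0].
  exists (fun=> 0); first exact: minorant0.
  rewrite /multiaffine big1 => [|S _]; last by rewrite mul0r.
  rewrite (le_trans (headprod_le_levelled l_dec l_ge0 wl adm)) //.
  by rewrite headprod_levelled0.
set tau := levelled k theta l.
have tau_gt0 i : 0 < tau 0 i by exact: lt_le_trans th_gt0 (levelled_ge i wl).
pose mu i := l 0 i / tau 0 i.
have mu01 i : 0 <= mu i <= 1.
  rewrite /mu divr_ge0 ?(ltW (tau_gt0 i)) //= ler_pdivrMr // mul1r.
  exact: le_levelled wl.
have [H [HH Hmu]] := isometry_with_diag mu01 (levelled_ratio_sum wl th_gt0).
have [c_ge0 _] := frame_weight_am_gm H; set c := frame_weight H in c_ge0.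
pose w (h : {ffun 'I_s -> 'I_d}) : R :=
  (\sum_f c f * \det (mxsub f h (P *m V)) ^+ 2) / (s`!)%:R.
have polyE (y : 'rV[R]_d) : \sum_h w h * \prod_i y 0 (h i) =
    \sum_f c f * \det (mxsub f f (P *m F y *m P^T)).
  have -> : P *m F y *m P^T = (P *m V) *m diag_mx y *m (P *m V)^T.
    by rewrite trmx_mul /F !mulmxA.
  apply: (mulfI (lt0r_neq0 (natr_fact_gt0 R s))).
  rewrite !mulr_sumr.
  under [RHS]eq_bigr do rewrite mulrCA fact_mul_minor mulr_sumr.
  rewrite exchange_big /=; apply: eq_bigr => h _.
  rewrite mulrA /w mulrC [_ * (_ / _)]mulrCA divff ?mulr1 ?gt_eqF ?natr_fact_gt0 //.
  by rewrite mulr_sumr; apply: eq_bigr => f _; rewrite mulrCA.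
have [q [q_ge0 q_card qE]] : exists q : {set 'I_d} -> R,
    [/\ forall S, 0 <= q S, forall S : {set 'I_d}, #|S| != s -> q S = 0 &
        forall y, multiaffine q y = \sum_f w f * \prod_i y 0 (f i)].
  apply: multiaffine_of_injections => [h|h h_ninj].
    rewrite divr_ge0 ?ler0n // sumr_ge0 // => f _.
    by rewrite mulr_ge0 ?c_ge0 ?sqr_ge0.
  rewrite /w big1 ?mul0r // => f _.
  by rewrite det_mxsub_ninj // expr0n mulr0.
exists q.
  split=> // y b y_ge0 le_b; rewrite qE polyE.
  have [k' [theta' wl']] := water_level_exists sd (F_dec y) (F_ge0 y y_ge0).
  have [xi' adm' hp'] := headprod_levelled_attained (F_dec y) (F_ge0 y y_ge0) wl'.
  apply: le_trans (le_b xi' adm'); rewrite hp'.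
  pose A := P *m (V *m diag_mx (\row_i Num.sqrt (y 0 i))).
  have AE : P *m F y *m P^T = A *m A^T.
    by rewrite /F diag_mx_sqrt_gram // /A (trmx_mul P) !mulmxA.
  have lE : eigvals (A *m A^T) = eigvals (F y) by rewrite -AE eigvals_orthogonal.
  rewrite AE -lE; apply: minor_sum_le_headprod; last by rewrite lE.
  exact: frame_weight_am_gm.
rewrite qE polyE FE.
have -> : P *m (P^T *m diag_mx l *m P) *m P^T = diag_mx l.
  by rewrite !mulmxA PP mul1mx -mulmxA PP mulmx1.
apply: (le_trans (headprod_le_levelled l_dec l_ge0 wl adm)).
(* Where det (H_f) is nonzero, f hits every place j < k, so that the entries
   of tau along f multiply up to the full value. *)
have termE (f : {ffun 'I_s -> 'I_d}) : c f * \det (mxsub f f (diag_mx l)) =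
    headprod s tau / (s`!)%:R * \det (rowsub f H) ^+ 2.
  have [det0|det_neq0] := eqVneq (\det (rowsub f H)) 0.
    by rewrite /c /frame_weight det0 expr0n mul0r mul0r mulr0.
  have f_inj : injective f.
    apply: contrapT => /(@det_colsub_ninj _ _ _ f H^T); rewrite -det_tr.
    have -> : (colsub f H^T)^T = rowsub f H by apply/matrixP => i j; rewrite !mxE.
    by move/eqP; rewrite (negPf det_neq0).
  have -> : mxsub f f (diag_mx l) = diag_mx (\row_i l 0 (f i)).
    by apply/matrixP => i j; rewrite !mxE (inj_eq f_inj).
  have mu_neq0 i : mu (f i) != 0.
    apply: contra det_neq0 => /eqP mu0; rewrite (expand_det_row _ i) big1 // => k' _.
    by rewrite mxE (@gram_diag_eq0 _ _ _ H) ?mul0r // Hmu.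
  have f_hits (j : 'I_d) : (j < k)%N -> exists i, f i = j.
    move=> jk; apply: contrapT => /forallNP fj; case/eqP: det_neq0.
    apply: (row_unit_det_rowsub_eq0 HH (j := j)) => //.
    have tj : tau 0 j = l 0 j by rewrite mxE jk.
    by rewrite Hmu /mu tj divff // -tj gt_eqF.
  rewrite -(prod_injective_eq_headprod wl th_gt0 f_inj f_hits) det_diag.
  rewrite /c /frame_weight.
  rewrite (eq_bigr (fun i => mu (f i))) => [|i _]; last exact: Hmu.
  rewrite [\prod_(i < s) (\row__ _) _ _](eq_bigr
    (fun i => mu (f i) * tau 0 (f i))) => [|i _].
    rewrite [\prod_(i < s) (mu _ * tau _ _)]big_split /= -/tau.
    have mu_prod : \prod_i mu (f i) != 0 by apply/prodf_neq0.
    by have F0 := lt0r_neq0 (natr_fact_gt0 R s); field; rewrite F0.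
  by rewrite mxE /mu divfK ?gt_eqF.
rewrite (eq_bigr _ (fun f _ => termE f)) -mulr_sumr.
have -> : \sum_(f : {ffun 'I_s -> 'I_d}) \det (rowsub f H) ^+ 2 = (s`!)%:R.
  have := sum_det_rowsub_sqr H (const_mx 1).
  rewrite diag_const_mx mulmx1 HH det1 mulr1 => <-; apply: eq_bigr => f _.
  by rewrite big1 ?mul1r // => i _; rewrite mxE.
by rewrite divfK ?gt_eqF ?natr_fact_gt0.
Qed.

(** * Maximizers of a multiaffine polynomial *)

(** The partial derivative in y_j; it is a polynomial in the other variables
    only. *)
Definition multiaffine_partial {R : realType} {d : nat} (q : {set 'I_d} -> R)
    (j : 'I_d) (y : 'rV[R]_d) : R :=
  \sum_(S : {set 'I_d} | j \in S) q S * \prod_(i in S :\ j) y 0 i.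

Lemma multiaffine_shift (R : realType) (d : nat) (q : {set 'I_d} -> R)
    (y : 'rV[R]_d) (j : 'I_d) (t : R) :
  multiaffine q (y + t *: delta_mx 0 j) =
  multiaffine q y + t * multiaffine_partial q j y.
Proof.
have off (i : 'I_d) : i != j -> (y + t *: delta_mx 0 j) 0 i = y 0 i.
  by move=> ij; rewrite !mxE eqxx (negPf ij) mulr0 addr0.
rewrite /multiaffine mulr_sumr [X in _ = _ + X]big_mkcond -big_split /=.
apply: eq_bigr => S _; case: ifPn => [jS|jS]; last first.
  rewrite addr0; congr (_ * _); apply: eq_bigr => i iS.
  by rewrite off //; apply: contraNneq jS => <-.
rewrite !(big_setD1 j jS) /=.
rewrite (eq_bigr (fun i => y 0 i)) => [|i]; last first.
  by rewrite !inE => /andP[ij _]; rewrite off.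
by rewrite !mxE !eqxx mulr1; ring.
Qed.

(** The partial derivative is again multiaffine, with the coefficient of S
    taken from the set S with j added. *)
Lemma multiaffine_partial_shift (R : realType) (d : nat) (q : {set 'I_d} -> R)
    (y : 'rV[R]_d) (i j : 'I_d) : (forall S, 0 <= q S) -> (forall i, 0 <= y 0 i) -> i != j ->
  exists2 K, 0 <= K &
  forall t, multiaffine_partial q j (y + t *: delta_mx 0 i) =
            multiaffine_partial q j y + t * K.
Proof.
move=> q_ge0 y_ge0 ij.
pose q' (S : {set 'I_d}) := if j \in S then 0 else q (j |: S)%SET.
have partialE z : multiaffine_partial q j z = multiaffine q' z.
  rewrite /multiaffine_partial /multiaffine.
  rewrite [RHS](bigID (fun S : {set 'I_d} => j \in S)) /=.
  rewrite [X in _ = X + _]big1 ?add0r => [|S jS]; last by rewrite /q' jS mul0r.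
  rewrite (reindex_onto (fun S => j |: S)%SET (fun S => S :\ j)%SET) /=; last first.
    by move=> S jS; rewrite finset.setD1K.
  rewrite [LHS](eq_bigl (fun S : {set 'I_d} => j \notin S)) => [|S]; last first.
    rewrite finset.setU11 /=; apply/eqP/idP => [<-|jS]; first by rewrite !inE eqxx.
    by rewrite finset.setU1K.
  by apply: eq_bigr => S jS; rewrite /q' (negPf jS) finset.setU1K.
exists (multiaffine_partial q' i y).
  apply: sumr_ge0 => S _; rewrite mulr_ge0 ?prodr_ge0 // /q'.
  by case: ifP.
by move=> t; rewrite !partialE multiaffine_shift.
Qed.

Lemma multiaffine_partial_weighted (R : realType) (d : nat)
    (q : {set 'I_d} -> R) (y : 'rV[R]_d) (j : 'I_d) :
  y 0 j * multiaffine_partial q j y =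
  \sum_(S : {set 'I_d} | j \in S) q S * \prod_(i in S) y 0 i.
Proof.
rewrite mulr_sumr; apply: eq_bigr => S jS.
by rewrite (big_setD1 j jS) /= mulrCA.
Qed.

Lemma multiaffine_ge0 (R : realType) (d : nat) (q : {set 'I_d} -> R)
    (y : 'rV[R]_d) :
  (forall S, 0 <= q S) -> (forall i, 0 <= y 0 i) -> 0 <= multiaffine q y.
Proof.
by move=> q_ge0 y_ge0; apply: sumr_ge0 => S _; rewrite mulr_ge0 ?prodr_ge0.
Qed.

Lemma sum_weighted_mem (R : realType) (d : nat) (w : 'I_d -> R)
    (a : {set 'I_d} -> R) :
  \sum_j w j * (\sum_(S : {set 'I_d} | j \in S) a S) =
  \sum_(S : {set 'I_d}) a S * \sum_(j in S) w j.
Proof.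
under eq_bigr do rewrite big_mkcond mulr_sumr.
rewrite exchange_big; apply: eq_bigr => S _ /=.
rewrite mulr_sumr [RHS]big_mkcond; apply: eq_bigr => j _.
by case: ifP => _; rewrite ?mulr0 // mulrC.
Qed.

(** Moving a small mass t from x_i to x_j keeps x feasible and changes the
    polynomial by t (D_j - D_i) - t^2 K, where D_i and D_j are the partial
    derivatives and K >= 0 is the mixed one. *)
Lemma maximizer_partial_le (R : realType) (d s : nat) (q : {set 'I_d} -> R)
    (x : 'rV[R]_d) (i j : 'I_d) :
  (forall S, 0 <= q S) -> feasible R d s x ->
  (forall x', feasible R d s x' -> multiaffine q x' <= multiaffine q x) ->
  i != j -> 0 < x 0 i -> x 0 j < 1 ->
  multiaffine_partial q j x <= multiaffine_partial q i x.
Proof.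
move=> q_ge0 [x01 xs] x_max ij xi xj.
have x_ge0 a : 0 <= x 0 a by have /andP[] := x01 a.
have [K K_ge0 KE] := multiaffine_partial_shift q_ge0 x_ge0 ij.
rewrite leNgt; apply/negP.
set Di := multiaffine_partial q i x; set Dj := multiaffine_partial q j x => lt.
(* The denominator K + 1 makes t K strictly smaller than Dj - Di. *)
pose t := Num.min (Num.min (x 0 i) (1 - x 0 j)) ((Dj - Di) / (K + 1)).
have K1 : 0 < K + 1 by rewrite ltr_wpDl.
have t_gt0 : 0 < t by rewrite !lt_min xi subr_gt0 xj divr_gt0 // subr_gt0.
have [txi txj tK] : [/\ t <= x 0 i, t <= 1 - x 0 j & t * (K + 1) <= Dj - Di].
  by rewrite -ler_pdivlMr // !ge_min !lexx !orbT.
have := x_max (x + (- t) *: delta_mx 0 i + t *: delta_mx 0 j).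
rewrite multiaffine_shift KE multiaffine_shift -/Di -/Dj => x'_le.
have ind (b : 'I_d) : \sum_(a < d) (a == b)%:R = 1 :> R.
  by rewrite (bigD1 b) //= eqxx big1 ?addr0 // => a /negPf ->.
have feas' : feasible R d s (x + (- t) *: delta_mx 0 i + t *: delta_mx 0 j).
  split=> [a|].
    rewrite !mxE eqxx /=; have [->|ai] := eqVneq a i.
      by have xi1 := x01 i; rewrite (negPf ij) mulr0n mulr1n; lra.
    have [->|aj] := eqVneq a j; first by have xj0 := x01 j; rewrite mulr0n mulr1n; lra.
    by have xa := x01 a; rewrite mulr0n; lra.
  rewrite (eq_bigr (fun a => x 0 a + (t * (a == j)%:R - t * (a == i)%:R))) => [|a _].
    by rewrite big_split sumrB -!mulr_sumr !ind xs subrr /= addr0.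
  by rewrite !mxE eqxx /=; ring.
have := x'_le feas' => {}x'_le.
have : t * (Dj - Di - t * K) <= 0 by lra.
by rewrite pmulr_rle0 //; lra.
Qed.

(** With M the maximum, D_j the partial derivative in x_j, and
    m_j = x_j D_j the weight of the subsets containing
    j, one has m_j <= M and sum_j m_j = s M = sum_j x_j M. If D_i < M for
    some i with x_i > 0, then m_j <= x_j M for all j: where x_j < 1 because
    D_j <= D_i, where x_j = 1 because m_j <= M. The sums would differ. So
    D_i >= M on the support, and equality of the sums forces equality of the
    terms. *)
Lemma maximizer_marginals (R : realType) (d s : nat) (q : {set 'I_d} -> R)
    (x : 'rV[R]_d) :
  (forall S, 0 <= q S) -> (forall S : {set 'I_d}, #|S| != s -> q S = 0) ->
  feasible R d s x ->
  (forall x', feasible R d s x' -> multiaffine q x' <= multiaffine q x) ->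
  forall j, x 0 j * multiaffine_partial q j x = x 0 j * multiaffine q x.
Proof.
move=> q_ge0 q_card x_feas x_max; have [x01 xs] := x_feas; set M := multiaffine q x.
have x_ge0 a : 0 <= x 0 a by have /andP[] := x01 a.
have term_ge0 (S : {set 'I_d}) : 0 <= q S * \prod_(i in S) x 0 i.
  by rewrite mulr_ge0 ?prodr_ge0.
have sum_marg : \sum_j x 0 j * multiaffine_partial q j x = \sum_j x 0 j * M.
  rewrite -mulr_suml xs.
  transitivity (\sum_j 1 * \sum_(S : {set 'I_d} | j \in S)
      q S * \prod_(i in S) x 0 i).
    by apply: eq_bigr => j _; rewrite multiaffine_partial_weighted mul1r.
  rewrite (sum_weighted_mem (fun=> 1) (fun S => q S * \prod_(i in S) x 0 i)).
  rewrite mulr_sumr.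
  apply: eq_bigr => S _; rewrite sumr_const.
  have [->|/q_card ->] := eqVneq #|S| s; first by rewrite mulrC.
  by rewrite !mul0r mulr0.
have marg_le j : x 0 j * multiaffine_partial q j x <= M.
  rewrite multiaffine_partial_weighted /M /multiaffine.
  rewrite [leRHS](bigID (fun S : {set 'I_d} => j \in S)) /=.
  by rewrite lerDl sumr_ge0.
have partial_ge i : 0 < x 0 i -> M <= multiaffine_partial q i x.
  move=> xi; rewrite leNgt; apply/negP => Di.
  have le_j j : x 0 j * multiaffine_partial q j x <= x 0 j * M.
    have [xj1|xj1] := eqVneq (x 0 j) 1; first by rewrite [in leRHS]xj1 mul1r.
    apply: ler_wpM2l => //; have [->|ji] := eqVneq j i; first exact: ltW.
    apply: le_trans (ltW Di); apply: (maximizer_partial_le q_ge0 x_feas) => //.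
      by rewrite eq_sym.
    by have /andP[_] := x01 j; rewrite le_eqVlt (negPf xj1).
  suff : \sum_j x 0 j * multiaffine_partial q j x < \sum_j x 0 j * M.
    by rewrite sum_marg ltxx.
  rewrite (bigD1 i) //= [ltRHS](bigD1 i) //=; apply: ltr_leD.
    by rewrite ltr_pM2l.
  by apply: ler_sum.
have diff_ge0 j : 0 <= x 0 j * multiaffine_partial q j x - x 0 j * M.
  have [->|xj] := eqVneq (x 0 j) 0; first by rewrite !mul0r subrr.
  by rewrite -mulrBr mulr_ge0 // subr_ge0 partial_ge // lt_neqAle eq_sym xj x_ge0.
have /psumr_eq0P diff0 :
    forall j, true -> 0 <= x 0 j * multiaffine_partial q j x - x 0 j * M.
  by move=> j _.
move=> j; apply/eqP; rewrite -subr_eq0; apply/eqP; apply: diff0 => //.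
by rewrite sumrB sum_marg subrr.
Qed.

(** Jensen's inequality, from e^z >= 1 + z applied to the deviation of
    sum_(j in S) rho_j from its mean under the weights q_S prod x_j. *)
Lemma multiaffine_exp_ge (R : realType) (d : nat) (q : {set 'I_d} -> R)
    (x rho : 'rV[R]_d) :
  (forall S, 0 <= q S) -> (forall i, 0 <= x 0 i) ->
  (forall j, x 0 j * multiaffine_partial q j x = x 0 j * multiaffine q x) ->
  multiaffine q x * expR (\sum_j x 0 j * rho 0 j) <=
  multiaffine q (\row_j (expR (rho 0 j) * x 0 j)).
Proof.
move=> q_ge0 x_ge0 marg; set M := multiaffine q x; set m := \sum_j _.
pose a (S : {set 'I_d}) := q S * \prod_(i in S) x 0 i.
pose r (S : {set 'I_d}) := \sum_(i in S) rho 0 i.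
have a_ge0 S : 0 <= a S by rewrite mulr_ge0 ?prodr_ge0.
have -> : multiaffine q (\row_j (expR (rho 0 j) * x 0 j)) =
    \sum_S a S * expR (r S).
  apply: eq_bigr => S _; rewrite (eq_bigr _ (fun i _ => mxE _ _ _ _)) big_split /=.
  by rewrite -expR_sum mulrCA mulrC.
have -> : M * expR m = \sum_S a S * (1 + (r S - m)) * expR m.
  rewrite -mulr_suml; congr (_ * _).
  under eq_bigr do rewrite mulrDr mulr1 mulrBr.
  rewrite big_split sumrB /= -mulr_suml -/(multiaffine q x) -/M.
  suff -> : \sum_S a S * r S = M * m by rewrite subrr addr0.
  rewrite -(sum_weighted_mem (fun j => rho 0 j)) mulr_sumr; apply: eq_bigr => j _.
  by rewrite -multiaffine_partial_weighted marg -/M; ring.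
apply: ler_sum => S _; rewrite -mulrA; apply: ler_wpM2l => //.
rewrite -{2}(subrK m (r S)) expRD; apply: ler_wpM2r; first exact: expR_ge0.
exact: expR_ge1Dx.
Qed.

(** * The optimal pair *)

(** The coefficient of S is at most the value at the indicator vector of S. *)
Lemma minorant_bounded (R : realType) (d s : nat) (V : 'M[R]_d)
    (S : {set 'I_d}) :
  (0 < s <= d)%N -> exists b, forall q, minorant s V q -> q S <= b.
Proof.
move=> sd; pose y : 'rV[R]_d := \row_j (j \in S)%:R.
have y_ge0 i : 0 <= y 0 i by rewrite mxE ler0n.
pose X := V *m diag_mx y *m V^T.
have l_ge0 i : 0 <= eigvals X 0 i by exact: eigvals_weighted_gram_ge0.
have l_dec : nonincr (eigvals X) by exact: eigvals_weighted_gram_nonincr.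
have [k [theta wl]] := water_level_exists sd l_dec l_ge0.
exists (headprod s (levelled k theta (eigvals X))) => q [q_ge0 _ q_le].
apply: le_trans (q_le y _ y_ge0 _) => [|xi]; last exact: headprod_le_levelled.
rewrite /multiaffine (bigD1 S) //= big1 ?mulr1 => [|i iS]; last by rewrite mxE iS.
by rewrite lerDl sumr_ge0 // => S' _; rewrite mulr_ge0 ?prodr_ge0.
Qed.

(** Point and coefficients are treated as one point of a product of copies of
    the line, where Tychonoff's theorem gives a compact box; the remaining
    constraints are closed. *)
Lemma joint_maximizer (R : realType) (d s : nat) (V : 'M[R]_d) : (0 < s <= d)%N ->
  exists x q, [/\ feasible R d s x, minorant s V q &
    forall x' q', feasible R d s x' -> minorant s V q' ->
      multiaffine q' x' <= multiaffine q x].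
Proof.
move=> sd; pose I : eqType := ('I_d + {set 'I_d})%type.
pose W : topologicalType := prod_topology (fun _ : I => R : topologicalType).
pose xof (z : I -> R) : 'rV[R]_d := \row_j z (inl j).
pose qof (z : I -> R) (S : {set 'I_d}) : R := z (inr S).
pose join (x : 'rV[R]_d) (q : {set 'I_d} -> R) (i : I) : R :=
  match i with inl j => x 0 j | inr U => q U end.
have xofK x q : xof (join x q) = x by apply/rowP => j; rewrite mxE.
have [bnd bndP] := choice (fun S => minorant_bounded V S sd).
pose B (i : I) : set R := match i with
  | inl _ => `[0, 1]%classic
  | inr U => if #|U| == s then `[0, bnd U]%classic else `[0, 0]%classic end.
pose box : set W := [set z | forall i, B i (z i)].
have box_compact : compact box.
  apply: (@tychonoff I (fun=> R : topologicalType)) => -[j|S] /=.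
    exact: segment_compact.
  by case: ifP => _; exact: segment_compact.
have z_cont (i : I) : continuous (fun z : W => z i : R).
  exact: (@proj_continuous I (fun=> R : topologicalType) i).
pose cond (p : 'rV[R]_d * R) := (forall i, 0 <= p.1 0 i) /\
  forall xi, admissible (eigvals (V *m diag_mx p.1 *m V^T)) xi ->
    headprod s xi <= p.2.
pose A : set W := box `&` ([set z | \sum_j z (inl j) = s%:R] `&`
  \bigcap_(p in cond) [set z | multiaffine (qof z) p.1 <= p.2]).
have mul_cont (F K : W -> R) : continuous F -> continuous K ->
    continuous (fun z => F z * K z).
  by move=> F_cont K_cont z; exact: (@cvgM _ _ _ _ F K _ _ (F_cont z) (K_cont z)).
have sum_cont (J : finType) (F : J -> W -> R) : (forall j, continuous (F j)) ->
    continuous (fun z => \sum_j F j z).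
  by move=> F_cont; apply: continuous_big => //; exact: add_continuous.
have prod_cont (J : finType) (P : pred J) (F : J -> W -> R) :
    (forall j, continuous (F j)) -> continuous (fun z => \prod_(j | P j) F j z).
  by move=> F_cont; apply: continuous_big => //; exact: mul_continuous.
have A_compact : compact A.
  apply: compact_closedI => //; apply: closedI.
    apply: (@closed_comp _ _ (fun z : W => \sum_j z (inl j) : R) [set x | x = s%:R]).
      by move=> z _; apply: sum_cont => j; exact: (z_cont (inl j)).
    exact: closed_eq.
  apply: closed_bigI => p _.
  apply: (@closed_comp _ _ (fun z : W => multiaffine (qof z) p.1) [set x | x <= p.2]).
      move=> z _; apply: sum_cont => S.
    apply: (mul_cont (fun z => z (inr S)) (fun=> \prod_(i in S) p.1 0 i)).
      exact: (z_cont (inr S)).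
    exact: cst_continuous.
  exact: closed_le.
have AP z : A z <-> feasible R d s (xof z) /\ minorant s V (qof z).
  have xofE j : xof z 0 j = z (inl j) by rewrite mxE.
  have sumE : \sum_j xof z 0 j = \sum_j z (inl j) by exact: eq_bigr.
  split=> [[z_box [z_sum z_cap]]|[[x01 xs] [q_ge0 q_card q_le]]].
    split; first split.
    - by move=> j; rewrite xofE; have := z_box (inl j); rewrite /B /= in_itv.
    - by rewrite sumE.
    split=> [S|S|y b y_ge0 y_le].
    - have := z_box (inr S); rewrite /B; case: ifP => _; rewrite /= in_itv /=;
      by case/andP.
    - move=> /negPf cardS; have := z_box (inr S); rewrite /B cardS /= in_itv /=.
      by move=> /le_anti.
    - exact: (z_cap (y, b)).
  split; last split.
  - move=> [j|S] /=; first by rewrite in_itv /= -xofE.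
    case: ifP => [_|/negbT /q_card qS].
      by rewrite /= in_itv /= (q_ge0 S) (bndP S (qof z)).
    by rewrite /= in_itv /= -[z _]/(qof z S) qS lexx.
  - by rewrite /= -sumE.
  - by move=> [y b] [/= y_ge0 y_le]; exact: q_le.
have join_in x q : feasible R d s x -> minorant s V q -> A (join x q).
  by move=> x_feas q_min; apply/AP; rewrite xofK.
have A_neq0 : A !=set0.
  have d_gt0 : 0 < d%:R :> R by rewrite ltr0n; lia.
  exists (join (const_mx (s%:R / d%:R)) (fun=> 0)).
  apply: join_in; last exact: minorant0.
  split=> [i|].
    by rewrite mxE divr_ge0 ?ler0n //= ler_pdivrMr // mul1r ler_nat; lia.
  rewrite (eq_bigr (fun=> s%:R / d%:R)) => [|i _]; last by rewrite mxE.
  by rewrite sumr_const card_ord -[_ *+ d]mulr_natr divfK ?gt_eqF.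
have obj_cont : continuous (fun z : W => multiaffine (qof z) (xof z)).
  apply: sum_cont => S.
  apply: (mul_cont (fun z => z (inr S)) (fun z => \prod_(j in S) xof z 0 j)).
    exact: (z_cont (inr S)).
  apply: prod_cont => j; have -> : (fun z : W => xof z 0 j) = (fun z => z (inl j)).
    by apply/funext => z; rewrite mxE.
  exact: (z_cont (inl j)).
have [z] := compact_EVT_max A_neq0 A_compact (continuous_subspaceT obj_cont).
move=> /set_mem/AP[z_feas z_min] z_max; exists (xof z), (qof z).
split=> // x' q' x'_feas q'_min.
have := z_max (join x' q') (mem_set (join_in x' q' x'_feas q'_min)).
by rewrite xofK.
Qed.

(** * Passing to logarithms *)

Lemma oppe_lne0 (R : realType) : (- lne (0 : R)%:E = +oo :> \bar R)%E.
Proof. by rewrite le0_lneNy. Qed.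

Lemma oppe_lneM (R : realType) (a b : R) : 0 <= a -> 0 <= b ->
  (- lne (a * b)%:E = - lne a%:E + - lne b%:E :> \bar R)%E.
Proof.
have lneNy c : (- lne c%:E != -oo :> \bar R)%E.
  by rewrite /lne; case: ifP.
rewrite le_eqVlt => /predU1P[<- _|a0].
  by rewrite mul0r oppe_lne0 addye.
rewrite le_eqVlt => /predU1P[<-|b0].
  by rewrite mulr0 oppe_lne0 addey.
by rewrite !lne_EFin ?mulr_gt0 // lnM ?posrE // -!EFinN -EFinD opprD.
Qed.

Lemma sum_oppe_lne (R : realType) (d s : nat) (xi : 'rV[R]_d) :
  (forall i, 0 <= xi 0 i) ->
  (\sum_(i < d | (i < s)%N) - lne (xi 0 i)%:E = - lne (headprod s xi)%:E)%E.
Proof.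
move=> xi_ge0; rewrite /headprod.
pose K (e : \bar R) (r : R) := (0 <= r) /\ (e = - lne r%:E)%E.
suff [] : K (\sum_(i < d | (i < s)%N) - lne (xi 0 i)%:E)%E
    (\prod_(i < d | (i < s)%N) xi 0 i) by [].
elim/big_ind2: _ => [|e a e' b [a0 ->] [b0 ->]|i _]; last by split.
  by split=> //; rewrite lne1 oppe0.
by split; rewrite ?mulr_ge0 // oppe_lneM.
Qed.

Lemma oppe_lne_le (R : realType) (a b : R) : 0 <= a -> a <= b ->
  (- lne b%:E <= - lne a%:E :> \bar R)%E.
Proof.
move=> a0 ab; rewrite leeN2 lee_lne // in_itv /= lee_fin ?leey ?andbT //.
exact: le_trans ab.
Qed.

Lemma oppe_lne_headprod_ge (R : realType) (d s : nat) (X : 'M[R]_d) (M : R) :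
  0 <= M -> 
  (forall xi, admissible (eigvals X) xi -> headprod s xi <= M) ->
  (- lne M%:E <= G s X)%E.
Proof.
move=> M_ge0 le_M; apply: le_ereal_inf_tmp => _ [xi xi_adm <-].
have [xi_ge0 _ _] := xi_adm; rewrite sum_oppe_lne //.
by apply: oppe_lne_le; [exact: prodr_ge0|exact: le_M].
Qed.

Lemma G_le_oppe_lne_headprod (R : realType) (d s : nat) (X : 'M[R]_d)
    (xi : 'rV[R]_d) :
  admissible (eigvals X) xi -> (G s X <= - lne (headprod s xi)%:E)%E.
Proof.
move=> xi_adm; apply: ereal_inf_lbound; exists xi => //.
by have [xi_ge0 _ _] := xi_adm; rewrite sum_oppe_lne.
Qed.

Lemma f_Gamma_gE (R : realType) (d s : nat) (V : 'M[R]_d) (x rho : 'rV[R]_d) :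
  f_Gamma_g s V x rho =
  (G s (V *m diag_mx (\row_j (expR (rho 0 j) * x 0 j))%R *m V^T) +
   (\sum_i x 0 i * rho 0 i)%R%:E)%E.
Proof.
rewrite /f_Gamma_g -(mulmxA V).
suff -> : diag_mx (map_mx expR rho) *m diag_mx x =
    diag_mx (\row_j (expR (rho 0 j) * x 0 j)) by [].
by apply/matrixP => i j; rewrite mul_diag_mx !mxE mulrnAr.
Qed.

Unset Implicit Arguments.

Theorem theorem3 (R : realType) (d s : nat) (V C : 'M[R]_d)
    (s_ge1 : (1 <= s)%N) (s_le_d : (s <= d)%N)
    (C_def : C = V^T *m V) (s_le_rank : (s <= \rank C)%N) :
  ereal_inf [set ereal_sup [set f_Gamma_g s V x rho | rho in [set: 'rV[R]_d]]
            | x in feasible R d s]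
  = ereal_inf [set f_Gamma_g s V x 0 | x in feasible R d s].
Proof.
have sd : (0 < s <= d)%N by rewrite s_ge1.
apply/le_anti/andP; split; last first.
  apply: le_ereal_inf_tmp => _ [x x_feas <-].
  apply: (@le_trans _ _ (f_Gamma_g s V x 0)).
    by apply: ereal_inf_lbound; exists x.
  by apply: ereal_sup_ubound; exists 0.
have [x [q [x_feas q_min q_max]]] := joint_maximizer V sd.
have [q_ge0 q_card _] := q_min; set M := multiaffine q x in q_max *.
have x_ge0 i : 0 <= x 0 i by have [x01 _] := x_feas; have /andP[] := x01 i.
have M_ge0 : 0 <= M by exact: multiaffine_ge0.
apply: (@le_trans _ _ (- lne M%:E)%E); last first.
  apply: le_ereal_inf_tmp => _ [x' x'_feas <-].
  have x'_ge0 i : 0 <= x' 0 i by have [x01 _] := x'_feas; have /andP[] := x01 i.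
  rewrite f_Gamma_gE [X in (_ + X%:E)%E]big1 ?adde0 => [|i _]; last first.
    by rewrite mxE mulr0.
  have -> : \row_j (expR ((0 : 'rV[R]_d) 0 j) * x' 0 j) = x'.
    by apply/rowP => j; rewrite !mxE expR0 mul1r.
  apply: oppe_lne_headprod_ge => // xi xi_adm.
  have [q' q'_min q'_ge] := minorant_touching sd x'_ge0 xi_adm.
  exact: le_trans q'_ge (q_max _ _ x'_feas q'_min).
apply: ge_ereal_inf; eexists; first by exists x.
apply: ge_ereal_sup => _ [rho _ <-]; rewrite f_Gamma_gE.
have marg : forall j, x 0 j * multiaffine_partial q j x = x 0 j * multiaffine q x.
  apply: (maximizer_marginals q_ge0 q_card x_feas) => x' x'_feas.
  exact: q_max.
have q_exp := multiaffine_exp_ge rho q_ge0 x_ge0 marg; rewrite -/M in q_exp.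
set y := \row_j _ in q_exp *; set m := \sum_j _ in q_exp *.
have y_ge0 i : 0 <= y 0 i by rewrite mxE mulr_ge0 ?expR_ge0.
have [xi xi_adm xi_ge] := minorant_attained sd q_min y_ge0.
have [->|M_neq0] := eqVneq M 0; first by rewrite oppe_lne0 leey.
have M_gt0 : 0 < M by rewrite lt_neqAle eq_sym M_neq0.
rewrite -leeBrDr // (le_trans (G_le_oppe_lne_headprod s xi_adm)) //.
apply: (@le_trans _ _ (- lne (M * expR m)%:E)%E).
  by apply: oppe_lne_le (le_trans q_exp xi_ge); rewrite mulr_ge0 ?expR_ge0.
rewrite !lne_EFin ?mulr_gt0 ?expR_gt0 // lnM ?posrE ?expR_gt0 // expRK.
by rewrite -EFinN -EFinB opprD.
Qed.
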